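(* There is a universal constant $K>0$ such that for every integer $d \geq 3$ and every real $s \geq 1$, there exist a number $c > 0$ and a graph $G$ satisfying: 1. $G$ has uniform polynomial growth of degree $k$ for some $k \leq K s$. 2. $G$ is uniformly sphere-packed in $\mathbb{R}^d$. 3. For every $x \in V(G)$ and all integers $R' > R \geq 1$, there are at least $c R^s$ pairwise vertex-disjoint paths in $G$ from $S_G(x,R)$ to $S_G(x,R')$.
   Context: Graphs are connected and undirected (here possibly infinite), equipped with the path metric $d_G$. Write $B_G(x,R) = \{y \in V(G) : d_G(x,y) \leq R\}$ and $S_G(x,R) = \{y \in V(G) : d_G(x,y) = R\}$. A graph $G$ has uniform polynomial growth of degree $k$ (where $k \geq 1$) if there is a number $C \geq 1$ such that $C^{-1} R^k \leq |B_G(x,R)| \leq C R^k$ for all $x \in V(G)$ and all $R \geq 1$. A graph $G$ is sphere-packed in $\mathbb{R}^d$ if $G$ is the tangency graph of a collection of interior-disjoint spheres in $\mathbb{R}^d$ (the vertices are the spheres, which bound balls with pairwise disjoint interiors, and two spheres are adjacent exactly when they are tangent). It is $M$-uniformly sphere-packed in $\mathbb{R}^d$ if the collection can be chosen so that the ratio of the radii of any two tangent spheres lies in $[M^{-1},M]$, and it is uniformly sphere-packed in $\mathbb{R}^d$ if this holds for some $M<\infty$. *)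

(* Defs.v *)
From HB Require Import structures.
From mathcomp Require Import all_boot all_order all_algebra finmap.
From mathcomp Require Import all_classical all_reals all_analysis.

Set Implicit Arguments.
Unset Strict Implicit.
Unset Printing Implicit Defensive.

Import Order.TTheory GRing.Theory Num.Theory.

Local Open Scope classical_set_scope.
Local Open Scope ring_scope.

(* The vertex set may be infinite.  The empty graph, which would satisfy every
   "for all vertices" condition vacuously, is excluded by [graph_nonempty]. *)
Record connected_graph := ConnectedGraph {
  vertex :> choiceType;
  adj : rel vertex;
  adj_sym : symmetric adj;
  adj_irr : irreflexive adj;
  graph_nonempty : exists x : vertex, True;
  graph_connected : forall x y : vertex,
    exists p : seq vertex, path adj x p /\ last x p = y }.

Section PathMetric.
Variable G : connected_graph.

(* As with [path], the walk is [x :: p], so [size p] counts its edges. *)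
Definition walk_of_length (x y : G) (n : nat) : bool :=
  `[< exists p : seq G, [/\ path (@adj G) x p, last x p = y & size p = n] >].

Lemma walk_of_length_ex (x y : G) : exists n, walk_of_length x y n.
Proof.
have [p [xp xy]] := graph_connected x y.
by exists (size p); apply/asboolP; exists p.
Qed.

Definition gdist (x y : G) : nat := ex_minn (walk_of_length_ex x y).

Definition gball (R : realType) (x : G) (r : R) : set G :=
  [set y | (gdist x y)%:R <= r].

Definition gsphere (x : G) (n : nat) : set G := [set y | gdist x y = n].

Definition uniform_polynomial_growth (R : realType) (k : R) : Prop :=
  1 <= k /\
  exists C : R, 1 <= C /\
    forall (x : G) (r : R), 1 <= r ->
      [/\ finite_set (gball x r),
          C^-1 * r `^ k <= (#|` fset_set (gball x r)|)%:R
        & (#|` fset_set (gball x r)|)%:R <= C * r `^ k].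

Definition path_from_to (A B : set G) (p : seq G) : Prop :=
  exists (x : G) (q : seq G),
    [/\ p = x :: q, path (@adj G) x q, uniq (x :: q), A x & B (last x q)].

Definition disjoint_paths (A B : set G) (n : nat) (p : 'I_n -> seq G) : Prop :=
  (forall i, path_from_to A B (p i)) /\
  (forall i j, i <> j -> forall v : G, ~ (v \in p i /\ v \in p j)).

End PathMetric.

Section SpherePacking.
Variables (R : realType) (d : nat).

(* The library norm on ['rV[R]_d] is the sup norm, hence this definition. *)
Definition edist (x y : 'rV[R]_d) : R :=
  Num.sqrt (\sum_(i < d) (x ord0 i - y ord0 i) ^+ 2).

Definition esphere (a : 'rV[R]_d) (r : R) : set 'rV[R]_d :=
  [set z | edist a z = r].

Definition open_eball (a : 'rV[R]_d) (r : R) : set 'rV[R]_d :=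
  [set z | edist a z < r].

(* For interior-disjoint spheres only external tangency can occur. *)
Definition tangent (a : 'rV[R]_d) (r : R) (b : 'rV[R]_d) (s : R) : Prop :=
  exists z, esphere a r `&` esphere b s = [set z].

Definition interior_disjoint (V : Type) (a : V -> 'rV[R]_d) (r : V -> R) :
    Prop :=
  forall u v, u <> v -> open_eball (a u) (r u) `&` open_eball (a v) (r v) = set0.

(* Interior-disjointness makes [v |-> esphere (a v) (r v)] injective, so the
   vertices of [G] are in bijection with the spheres of the collection. *)
Definition sphere_packing_of (G : connected_graph) (a : G -> 'rV[R]_d)
    (r : G -> R) : Prop :=
  [/\ forall v, 0 < r v,
      interior_disjoint a r
    & forall u v, adj u v <-> u <> v /\ tangent (a u) (r u) (a v) (r v)].

Definition M_uniformly_sphere_packed (M : R) (G : connected_graph) : Prop :=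
  exists (a : G -> 'rV[R]_d) (r : G -> R),
    sphere_packing_of a r /\
    forall u v, u <> v -> tangent (a u) (r u) (a v) (r v) ->
      M^-1 <= r u / r v <= M.

Definition uniformly_sphere_packed (G : connected_graph) : Prop :=
  exists M : R, M_uniformly_sphere_packed M G.

End SpherePacking.

(* Main.v *)
(* A finite gadget of axis-parallel cubes inside a cube is substituted into
   each of its cubes, again and again; the inscribed spheres of the resulting
   cubes form the packing.  Cubes of sides r^3, r^2, r, 1 form straight arms from
   a central hub to the middle of the six faces of the gadget.  They connect any
   two faces by 11 cubes, and no path between two faces is shorter, so distances
   grow by exactly 11 in each step.  Since in three dimensions these highways
   separate nothing, w = (r - 1) / 2 disjoint nets of unit cubes run around them,
   each touching all faces.  The number P of cubes is polynomial in w, so the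
   growth exponent log P / log 11 is at most a constant times log w / log 11,
   while w^n disjoint paths cross a cube of level n, whose diameter is about
   11^n.  A small cube touches a larger one in the middle of its face; to match
   the nets of both, every face carries ports at the two scales r and r^2. *)

Require Import Defs.
From mathcomp Require Import all_boot all_order all_algebra finmap.
From mathcomp Require Import all_classical all_reals all_analysis.
From mathcomp Require Import zify ring lra.

Import Order.TTheory GRing.Theory Num.Theory.

Local Open Scope classical_set_scope.
Local Open Scope ring_scope.

Set Implicit Arguments.
Unset Strict Implicit.
Unset Printing Implicit Defensive.

(** * Path metric *)

(** Inscribed spheres of two touching cubes are tangent only if the touching faces have a common
    centre. Hence a cube has at most one neighbour on each face, and where two subdivided cubes
    meet, their boundary cubes must be either exactly aligned or apart. Ports at multiples of r on a
    single line through the centre of the face achieve this for equal cubes and for cubes of ratio r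
    alike. The choice r = 2w + 1 makes room for w multiples of r below r^2 and for w multiples of
    r^2 below r^3; being odd, it keeps all centres integral. The faces are therefore about r^3 wide,
    and an arm of boundedly many cubes, whose sides may change only by the factor r, spans this
    width by starting from a hub of side r^3.

    The nets must not offer shortcuts. For each face an integer function on the gadget, 0 on that
    face, 10 on the other five and changing by at most 1 along contacts, shows that they do not. *)

Section PathMetricFacts.
Variable G : connected_graph.
Implicit Types (x y z o : G) (s : seq G).
Local Open Scope nat_scope.

Lemma gdist_path x y :
  exists s, [/\ path (@adj G) x s, last x s = y & size s = gdist x y].
Proof. by rewrite /gdist; case: ex_minnP => n /asboolP. Qed.

Lemma gdist_le_size x y s :
  path (@adj G) x s -> last x s = y -> gdist x y <= size s.
Proof.
move=> xs xy; rewrite /gdist; case: ex_minnP => n _; apply.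
by apply/asboolP; exists s.
Qed.

Lemma gdistxx x : gdist x x = 0.
Proof. by apply/eqP; rewrite -leqn0 (@gdist_le_size x x [::]). Qed.

Lemma gdist_triangle x y z : gdist x z <= gdist x y + gdist y z.
Proof.
have [s [xs <- <-]] := gdist_path x y; have [t [yt <- <-]] := gdist_path (last x s) z.
by rewrite -size_cat gdist_le_size ?last_cat // cat_path xs.
Qed.

Lemma gdist_sym x y : gdist x y = gdist y x.
Proof.
suff le (u v : G) : gdist u v <= gdist v u by apply/eqP; rewrite eqn_leq !le.
have [s [vs <- <-]] := gdist_path v u.
rewrite -(size_belast v) -size_rev gdist_le_size //.
- by rewrite rev_path (@eq_path _ _ (@adj G)) // => a b; rewrite adj_sym.
- by case: s {vs} => //= a s; rewrite rev_cons last_rcons.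
Qed.

Lemma gdist_adj o x y : adj x y -> gdist o y <= (gdist o x).+1.
Proof.
move=> xy; apply: leq_trans (gdist_triangle o x y) _.
by rewrite -addn1 leq_add2l (@gdist_le_size x y [:: y]) //= xy.
Qed.

(** A discrete intermediate value argument: one step changes the distance from [o] by at most 1. *)
Lemma path_hits_sphere o x s n :
  path (@adj G) x s -> gdist o x <= n -> n <= gdist o (last x s) ->
  exists s1 s2, s = s1 ++ s2 /\ gdist o (last x s1) = n.
Proof.
elim/last_ind: s => [|s y IH] /=.
  by move=> _ le1 le2; exists [::], [::]; split=> //=; apply/eqP; rewrite eqn_leq le1.
rewrite rcons_path last_rcons => /andP[xs sy] le1 le2.
have [le3|lt3] := leqP n (gdist o (last x s)).
  have [s1 [s2 [-> <-]]] := IH xs le1 le3.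
  by exists s1, (rcons s2 y); rewrite rcons_cat.
exists (rcons s y), [::]; rewrite cats0 last_rcons; split=> //.
by have := gdist_adj o sy; lia.
Qed.

(** The path is carved out of the walk and uses only its vertices, so disjoint walks yield disjoint
    paths. *)
Lemma path_between_spheres o x s a b :
  path (@adj G) x s -> gdist o x <= a -> a <= b -> b <= gdist o (last x s) ->
  exists p, path_from_to (gsphere o a) (gsphere o b) p /\ {subset p <= x :: s}.
Proof.
move=> xs le1 ab le2.
have [s1 [s2 [es ea]]] := path_hits_sphere xs le1 (leq_trans ab le2).
move: xs; rewrite es cat_path => /andP[xs1 xs2].
have le3 : b <= gdist o (last (last x s1) s2) by rewrite -last_cat -es.
have le4 : gdist o (last x s1) <= b by rewrite ea.
have [t1 [t2 [et eb]]] := path_hits_sphere xs2 le4 le3.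
move: xs2 eb; rewrite et cat_path => /andP[xt1 _].
case: (shortenP xt1) => t xt ut sub eb.
exists (last x s1 :: t); split; first by exists (last x s1), t; split.
move=> v; rewrite inE => /orP[/eqP->|/sub vt1].
  by rewrite -(cat_cons x) mem_cat mem_last.
by rewrite inE !mem_cat vt1 !orbT.
Qed.

End PathMetricFacts.

(** * Substitution graphs *)

Definition dir : Type := ('I_3 * bool)%type.
Definition opp (d : dir) : dir := (d.1, ~~ d.2).

Lemma oppK : involutive opp.
Proof. by case=> k b; rewrite /opp negbK. Qed.

Lemma opp_neq d : opp d <> d.
Proof. by case: d => k b []; case: b. Qed.

(* The vertices of the graph are the natural numbers written in base [base]:
   replacing every vertex [q] by the digits [q * base + u] maps the graph to
   itself, so that [x %/ base ^ n] is the copy of level [n] containing [x].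
   [contact d x y] says that [y] is the neighbour of [x] in direction [d], and
   [face d u] that the digit [u] lies on the boundary in direction [d].  A
   contact of type [(a, b)] between [q] and [q'] is replaced by contacts between
   the ports [port d a i] and [port (opp d) b i]; the index [0] is the short
   central connection, the others are the terminals of the disjoint nets. *)
Record substitution := Substitution {
  base : nat;
  scale : nat;
  width : nat;
  contact : dir -> nat -> nat -> Prop;
  face : dir -> nat -> Prop;
  tcontact : bool -> bool -> dir -> nat -> nat -> Prop;
  port : dir -> bool -> nat -> nat;
  depth : dir -> nat -> nat;
  net : nat -> nat -> Prop;
  touch := fun x y => `[< exists d, contact d x y >];
  base_gt1 : (1 < base)%N;
  scale_gt1 : (1 < scale)%N;
  contact_sym : forall d x y, contact d x y -> contact (opp d) y x;
  contact_inj : forall d x y z, contact d x y -> contact d x z -> y = z;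
  contact_irr : forall d x, ~ contact d x x;
  contact_local : forall d q u v, (u < base)%N -> (v < base)%N ->
    contact d (q * base + u) (q * base + v) <-> contact d u v;
  contact_cross : forall d q q' u v, (u < base)%N -> (v < base)%N ->
    q <> q' -> contact d (q * base + u) (q' * base + v) ->
    [/\ contact d q q', face d u & face (opp d) v];
  face_outer : forall d u v, (u < base)%N -> (v < base)%N ->
    face d u -> ~ contact d u v;
  tcontactW : forall a b d x y, tcontact a b d x y -> contact d x y;
  contact_typed : forall d x y, contact d x y ->
    exists a b, tcontact a b d x y;
  port_lt : forall d a i, (i <= width)%N -> (port d a i < base)%N;
  port_face : forall d a i, (i <= width)%N -> face d (port d a i);
  port_centre : forall d a b, port d a 0 = port d b 0;
  tcontact_port : forall a b d q q' i, (i <= width)%N ->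
    tcontact a b d q q' ->
    tcontact a b d (q * base + port d a i) (q' * base + port (opp d) b i);
  centre_path : forall d d', d <> d' ->
    exists s, [/\ path touch (port d true 0) s, uniq (port d true 0 :: s),
      all (fun u => u < base)%N s, last (port d true 0) s = port d' true 0
      & (size s).+1 = scale];
  depth_face : forall d u, (u < base)%N -> face d u -> depth d u = 0;
  depth_far : forall d d' u, (u < base)%N -> d <> d' -> face d' u ->
    (depth d u).+1 = scale;
  depth_step : forall d f u v, (u < base)%N -> (v < base)%N ->
    contact f u v -> (depth d v <= (depth d u).+1)%N;
  net_inj : forall i j u, net i u -> net j u -> i = j;
  net_path : forall i d a d' b, (0 < i <= width)%N ->
    exists s, [/\ path touch (port d a i) s, last (port d a i) s = port d' b i
      & forall u, u \in port d a i :: s -> (u < base)%N /\ net i u];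
  digit_path : forall u v, (u < base)%N -> (v < base)%N ->
    exists s, [/\ path touch u s, last u s = v & all (fun u => u < base)%N s] }.

Arguments contact {s}.
Arguments face {s}.
Arguments tcontact {s}.
Arguments depth {s}.
Arguments net {s}.
Arguments touch {s}.

Section Substitution.
Variable S : substitution.
Local Notation P := (base S).
Local Notation L := (scale S).
Local Notation C := (@contact S).
Local Notation CT := (@tcontact S).
Local Notation adjn := (@touch S).
Local Notation face := (@face S).
Local Notation depth := (@depth S).
Local Notation net := (@net S).
Local Open Scope nat_scope.

Lemma touchP x y : reflect (exists d, C d x y) (adjn x y).
Proof. exact: asboolP. Qed.

Lemma touch_sym : symmetric adjn.
Proof.
by move=> x y; apply/touchP/touchP => -[d /contact_sym]; exists (opp d).
Qed.

Lemma base_gt0 : 0 < P.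
Proof. exact: ltnW (base_gt1 S). Qed.

Lemma expn_base_gt0 n : 0 < P ^ n.
Proof. by rewrite expn_gt0 base_gt0. Qed.

Lemma scale_gt0 : 0 < L.
Proof. exact: ltnW (scale_gt1 S). Qed.

Lemma expn_scale_gt0 n : 0 < L ^ n.
Proof. by rewrite expn_gt0 scale_gt0. Qed.

Lemma divn_expnS x n : x %/ P ^ n.+1 = x %/ P ^ n %/ P.
Proof. by rewrite expnSr divnMA. Qed.

Lemma child_div q u : u < P -> (q * P + u) %/ P = q.
Proof. by move=> uP; rewrite divnMDl ?base_gt0 // divn_small // addn0. Qed.

Lemma child_mod q u : u < P -> (q * P + u) %% P = u.
Proof. by move=> uP; rewrite modnMDl modn_small. Qed.

Definition on_face n d x := forall j, j < n -> face d ((x %/ P ^ j) %% P).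

Lemma on_faceS n d x :
  on_face n.+1 d x <-> on_face n d x /\ face d ((x %/ P ^ n) %% P).
Proof.
split=> [H|[H1 H2] j]; first by split=> [j jn|]; apply: H; rewrite // ltnS ltnW.
by rewrite ltnS leq_eqVlt => /orP[/eqP-> //|]; apply: H1.
Qed.

Lemma contact_copy n d x y : C d x y -> x %/ P ^ n <> y %/ P ^ n ->
  [/\ C d (x %/ P ^ n) (y %/ P ^ n), on_face n d x & on_face n (opp d) y].
Proof.
move=> xy; elim: n => [|n IH]; first by rewrite expn0 !divn1.
rewrite !divn_expnS => neq.
have [|c fx fy] := IH; first by move=> e; apply: neq; rewrite e.
have mP z : z %% P < P by rewrite ltn_mod base_gt0.
rewrite (divn_eq (x %/ P ^ n) P) (divn_eq (y %/ P ^ n) P) in c.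
have [c' ? ?] := contact_cross (mP _) (mP _) neq c.
by split=> //; apply/on_faceS.
Qed.

Lemma contact_digit d q x y : x %/ P = q -> y %/ P = q -> C d x y ->
  C d (x %% P) (y %% P).
Proof.
move=> xq yq xy; apply/(@contact_local _ _ q); rewrite ?ltn_mod ?base_gt0 //.
by rewrite -{1}xq -yq -!divn_eq.
Qed.

Definition in_copy n q s := all (fun v => v %/ P ^ n == q) s.

(* In a copy of level n+1 a walk is cut into visits to copies of level n.  A
   visit which enters and leaves through the same face achieves nothing; every
   other visit costs [L ^ n], and moves from one contact to another one whose
   potential [maxn (depth d u) (depth d v)] is larger by at most 1. *)
Definition entry d e k u :=
  [/\ e = d, face d u & k = 0] \/
  exists v, [/\ v < P, C e u v & k = maxn (depth d u) (depth d v)].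

(** [pre] consists of the completed visits and [y :: cur] is the current one, entered at [y] through
    the face [e]. The potential [k] reached at this entry is already paid for by the length of
    [pre]. *)
Definition last_visit n d x s e k pre y cur :=
  [/\ x :: s = pre ++ y :: cur, path adjn y cur /\ last y cur = last x s,
      in_copy n (last x s %/ P ^ n) (y :: cur), on_face n e y
    & k * L ^ n <= size pre /\ entry d e k ((last x s %/ P ^ n) %% P)].

Definition crossing_bound n := forall q d d' x s, path adjn x s ->
  in_copy n q (x :: s) -> on_face n d x -> on_face n d' (last x s) ->
  d <> d' -> L ^ n <= (size s).+1.

Lemma last_visit_exists n q d x s : crossing_bound n ->
  path adjn x s -> in_copy n.+1 q (x :: s) -> on_face n.+1 d x ->
  exists e k pre y cur, last_visit n d x s e k pre y cur.
Proof.
move=> IHn; elim/last_ind: s => [|s z IH] /=.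
  rewrite andbT => _ xq /on_faceS[fx fx'].
  exists d, 0, [::], x, [::]; split=> //=; first by rewrite /in_copy /= eqxx.
  by split=> //; left.
rewrite rcons_path /in_copy /= all_rcons => /andP[xs sz] /and3P[xq zq sq] fx.
have [|e [k [pre [y [cur [def [yc ly] inc fy [kL ent]]]]]]] := IH xs _ fx.
  by rewrite /in_copy /= xq.
have lq : last x s %/ P ^ n.+1 = q.
  by have := mem_last x s; rewrite inE => /orP[/eqP->|/(allP sq)/eqP //]; apply/eqP.
case/touchP: sz => f cz.
have [eZ|neq] := eqVneq (last x s %/ P ^ n) (z %/ P ^ n).
  exists e, k, pre, y, (rcons cur z); rewrite /last_visit !last_rcons -eZ; split=> //.
  - by rewrite -rcons_cons def -rcons_cons rcons_cat.
  - by rewrite rcons_path yc ly; split=> //; apply/touchP; exists f.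
  - by move: inc; rewrite /in_copy -rcons_cons all_rcons -eZ eqxx.
have [Cf fl fz] := contact_copy cz (elimN eqP neq).
have Cu : C f ((last x s %/ P ^ n) %% P) ((z %/ P ^ n) %% P).
  by apply: (@contact_digit _ q) => //; rewrite -divn_expnS //; apply/eqP.
set u := (_ %% P) in Cu ent; set v := (_ %% P) in Cu.
have uP : u < P by rewrite ltn_mod base_gt0.
have vP : v < P by rewrite ltn_mod base_gt0.
exists (opp f), (maxn (depth d v) (depth d u)), (pre ++ y :: cur), z, [::].
rewrite /last_visit !last_rcons; split=> //=.
- by rewrite -def cats1.
- by rewrite /in_copy /= eqxx.
split; last by right; exists u; split=> //; apply: contact_sym.
rewrite size_cat.
(* Leaving through the face of entry leads back to the previous copy, the only neighbour on that
   face, and the potential is symmetric in the two copies. *)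
have [ef|nef] := eqVneq e f.
  case: ent => [[ed fu _]|[v' [v'P Cv kE]]].
    by case: (face_outer uP vP fu); rewrite -ed ef.
  have -> : v = v' by apply: contact_inj Cu _; rewrite -ef.
  by move: kL; rewrite kE maxnC => kL; rewrite (leq_trans kL) // leq_addr.
have : L ^ n <= (size cur).+1.
  by apply: (IHn _ _ _ _ _ yc inc fy _ (elimN eqP nef)); rewrite ly.
have : maxn (depth d v) (depth d u) <= k.+1.
  have dv := depth_step d uP vP Cu; rewrite geq_max.
  case: ent => [[_ fu ->]|[v' [_ _ ->]]].
    by rewrite (depth_face uP fu) in dv *; rewrite dv.
  by rewrite (leq_trans dv) ?ltnS ?leq_maxl // leqW ?leq_maxl.
move=> kk Ln; apply: (@leq_trans (k.+1 * L ^ n)); first by rewrite leq_mul2r kk orbT.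
by rewrite mulSn addnC leq_add.
Qed.

(** The walk ends in a copy on a face other than [d], where the depth is [L - 1]. So at least
    [L - 1] crossings are paid for before the last visit, and this visit, entered through a face
    different from [d'], is one more. *)
Lemma crossing n : crossing_bound n.
Proof.
elim: n => [|n IHn] // q d d' x s xs sq fx fx' dd'.
have [e [k [pre [y [cur [def [yc ly] inc fy [kL ent]]]]]]] := last_visit_exists IHn xs sq fx.
case/on_faceS: fx' => fl fu.
set u := (_ %% P) in fu ent; have uP : u < P by rewrite ltn_mod base_gt0.
have dep := depth_far uP dd' fu.
have ke : L <= k.+1.
  case: ent => [[_ fu' ->]|[v [_ _ ->]]]; rewrite -dep; last by rewrite ltnS leq_maxl.
  by rewrite (depth_face uP fu').
have ed' : e <> d'.
  case: ent => [[-> //]|[v [vP Cv _]] ee].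
  by apply: (face_outer uP vP fu); rewrite -ee.
have Ln : L ^ n <= (size cur).+1 by apply: IHn yc inc fy _ ed'; rewrite ly.
rewrite -[(size s).+1]/(size (x :: s)) def size_cat expnS.
apply: (@leq_trans (k.+1 * L ^ n)); first by rewrite leq_mul2r ke orbT.
by rewrite mulSn addnC leq_add.
Qed.

(** To get beyond a neighbouring copy, the walk would have to cross it between two different faces,
    which takes [L ^ n] vertices by [crossing]. *)
Lemma short_path_copy n x s : path adjn x s -> (size s).+1 < L ^ n ->
  let q := x %/ P ^ n in let q' := last x s %/ P ^ n in
  q' = q \/ exists f, C f q q'.
Proof.
move=> /= xs Ln; set q := x %/ P ^ n.
suff : last x s %/ P ^ n = q \/ exists f pre y cur,
    [/\ C f q (last x s %/ P ^ n), x :: s = pre ++ y :: cur,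
        path adjn y cur /\ last y cur = last x s,
        in_copy n (last x s %/ P ^ n) (y :: cur) & on_face n (opp f) y].
  by move=> [|[f [pre [y [cur []]]]]]; [left|right; exists f].
elim/last_ind: s xs Ln => [|s z IH] /=; first by left.
rewrite rcons_path size_rcons last_rcons => /andP[xs /touchP[f sz]] Ln.
have [eZ|neq] := eqVneq (last x s %/ P ^ n) (z %/ P ^ n).
  have [|l|[f' [pre [y [cur [Cf def [yc ly] inc fy]]]]]] := IH xs; first exact: ltnW.
    by left; rewrite -eZ.
  right; exists f', pre, y, (rcons cur z); rewrite -eZ; split=> //.
  - by rewrite -rcons_cons def -rcons_cons rcons_cat.
  - by rewrite rcons_path yc ly last_rcons; split=> //; apply/touchP; exists f.
  - by move: inc; rewrite /in_copy /= all_rcons /= -eZ eqxx.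
have [Cf fl fz] := contact_copy sz (elimN eqP neq).
have [|l|[f' [pre [y [cur [Cf' def [yc ly] inc fy]]]]]] := IH xs; first exact: ltnW.
  right; exists f, (x :: s), z, [::]; rewrite -l; split=> //=; first by rewrite cats1.
  by rewrite /in_copy /= eqxx.
have [e|ne] := eqVneq f (opp f').
  by left; apply: contact_inj Cf _; rewrite e; apply: contact_sym.
have : L ^ n <= (size cur).+1.
  apply: (crossing yc inc fy); first by rewrite ly; apply: fl.
  by apply/eqP; rewrite eq_sym.
have /(congr1 size) := def; rewrite size_cat /=; lia.
Qed.

(** Refinement of [q] along a word of port indices, coarsest letter first. A word of zeros leads to
    the central connection of the face [d], a word of positive letters to a terminal of a net inside
    a net, and so on. *)
Fixpoint wire q d a I : nat :=
  if I is i :: I' then wire (q * P + port S d a i) d a I' else q.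

Definition wire_index I := all (fun i => i <= width S) I.

Lemma wire_copy q d a I : wire_index I -> wire q d a I %/ P ^ size I = q.
Proof.
elim: I q => [|i I IH] q /=; first by rewrite expn0 divn1.
by case/andP=> iw Iw; rewrite divn_expnS IH // child_div // port_lt.
Qed.

Lemma wire_tcontact a b d q q' I : wire_index I -> CT a b d q q' ->
  CT a b d (wire q d a I) (wire q' (opp d) b I).
Proof.
elim: I q q' => [|i I IH] q q' //= /andP[iw Iw] c.
by apply: IH => //; apply: tcontact_port.
Qed.

Section Chain.
Variables (I : seq nat) (B : nat -> Prop) (M : nat).
Hypothesis Iw : wire_index I.
(* With [M = 0] no length is recorded. *)
Hypothesis cross : forall q d d' a b, d <> d' ->
  exists s, [/\ path adjn (wire q d a I) s, last (wire q d a I) s = wire q d' b I,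
    forall v, v \in wire q d a I :: s -> v %/ P ^ size I = q /\ B v
    & 0 < M -> size s < M].

(** Lifts a walk on copies to a walk inside them. Each copy must be crossed between two different
    faces: at the ends this is what the conditions on [e] and [e'] provide, in between it follows
    from [uniq], since there is only one neighbour in each direction. *)
Lemma chain q qs e a e' b : path adjn q qs -> uniq (q :: qs) ->
  (forall q', q' \in q :: qs -> ~ C e q q') ->
  (forall q', q' \in q :: qs -> ~ C e' (last q qs) q') ->
  (qs = [::] -> e <> e') ->
  exists s, [/\ path adjn (wire q e a I) s,
    last (wire q e a I) s = wire (last q qs) e' b I,
    forall v, v \in wire q e a I :: s -> v %/ P ^ size I \in q :: qs /\ B v
    & 0 < M -> size s < M * size (q :: qs)].
Proof.
elim: qs q e a => [|q1 qs IH] q e a /= => [_ _ _ _ /(_ erefl) ee'|].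
  have [s [h1 h2 h3 h4]] := cross q a b ee'.
  exists s; split=> //; last by rewrite muln1.
  by move=> v /h3[<-]; rewrite inE eqxx.
case/andP=> /touchP[f qq1] qs1 /andP[nq uq] he he' _.
have nef : e <> f by move=> ef; apply: (he q1); rewrite ?ef // !inE eqxx orbT.
have [a1 [b1 t1]] := contact_typed qq1.
have [s [h1 h2 h3 h4]] := cross q a a1 nef.
have c1 := contact_sym qq1.
have [|||s' [k1 k2 k3 k4]] := IH q1 (opp f) b1 qs1 uq.
- by move=> q' q'in /(contact_inj c1) E; move: nq; rewrite E q'in.
- by move=> q' q'in; apply: he'; rewrite inE q'in orbT.
- by move=> E fe; apply: (he' q); rewrite ?mem_head // E /= -fe.
exists (s ++ wire q1 (opp f) b1 I :: s'); split.
- rewrite cat_path h1 h2 /= k1 andbT; apply/touchP; exists f.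
  exact: tcontactW (wire_tcontact Iw t1).
- by rewrite last_cat.
- move=> v; rewrite -cat_cons mem_cat => /orP[/h3[-> Bv]|/k3[vq Bv]].
    by rewrite mem_head.
  by rewrite inE vq orbT.
- by move=> M0; have := h4 M0; have := k4 M0; rewrite size_cat /= !mulnS; lia.
Qed.

Lemma digit_chain q u us e a e' b : path adjn u us -> uniq (u :: us) ->
  (forall v, v \in u :: us -> v < P) ->
  (forall v, v \in u :: us -> ~ C e u v) -> face e' (last u us) ->
  (us = [::] -> e <> e') ->
  exists s, [/\ path adjn (wire (q * P + u) e a I) s,
    last (wire (q * P + u) e a I) s = wire (q * P + last u us) e' b I,
    forall v, v \in wire (q * P + u) e a I :: s ->
      [/\ v %/ P ^ (size I).+1 = q, (v %/ P ^ size I) %% P \in u :: us & B v]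
    & 0 < M -> size s < M * size (u :: us)].
Proof.
move=> pu uu uP fe fe' ee'.
have inP : forall v, v \in (q * P + u) :: map (addn (q * P)) us ->
    exists2 v', v' \in u :: us & v = q * P + v'.
  by move=> v; rewrite -map_cons => /mapP[v' v'in ->]; exists v'.
have lP : last u us < P by apply: uP; rewrite mem_last.
have [|||||s [h1 h2 h3 h4]] := @chain (q * P + u) (map (addn (q * P)) us) e a e' b.
- rewrite path_map; move: pu; apply: (@sub_in_path _ [pred v | v < P]); last first.
    by apply/allP => v; apply: uP.
  move=> v v' /= vP v'P /touchP[d c]; apply/touchP; exists d.
  exact/contact_local.
- by rewrite -map_cons map_inj_uniq // => v v' /addnI.
- move=> v /inP[v' v'in ->] /contact_local c.
  by apply: (fe v' v'in); apply: c; rewrite uP ?mem_head.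
- move=> v /inP[v' /uP v'P ->]; rewrite last_map => /contact_local c.
  exact: (face_outer lP v'P fe') (c lP v'P).
- by case: us ee' {pu uu uP fe fe' inP lP} => // ->.
exists s; split=> //; first by rewrite h2 last_map.
  move=> v /h3[/inP[v' v'in E] Bv]; rewrite divn_expnS E child_div ?child_mod //; exact: uP.
by move=> /h4; rewrite /= size_map.
Qed.

End Chain.

Lemma nseq0_index n : wire_index (nseq n 0).
Proof. by rewrite /wire_index all_nseq leq0n orbT. Qed.

(** The upper bound that matches [crossing]: the central route visits [L] subcopies, each crossed by
    a central route again. *)
Lemma centre_cross n q d d' a b : d <> d' ->
  exists s, [/\ path adjn (wire q d a (nseq n 0)) s,
    last (wire q d a (nseq n 0)) s = wire q d' b (nseq n 0),
    forall v, v \in wire q d a (nseq n 0) :: s ->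
      v %/ P ^ size (nseq n 0) = q /\ True
    & 0 < L ^ n -> size s < L ^ n].
Proof.
move=> dd'; elim: n q d d' a b dd' => [|n IH] q d d' a b dd'.
  exists [::]; split=> //= v; rewrite inE => /eqP->.
  by rewrite expn0 divn1.
have [us [pu uu uP lu su]] := centre_path S dd'.
have p0 e c : port S e c 0 = port S e true 0 := port_centre _ _ _ _.
have ltP e c : port S e c 0 < P by rewrite port_lt.
have [||||s [h1 h2 h3 h4]] :=
    @digit_chain (nseq n 0) _ (L ^ n) (nseq0_index n) IH q _ us d a d' b pu uu.
- by move=> v; rewrite inE => /orP[/eqP->|/(allP uP)].
- move=> v; rewrite inE => /orP[/eqP->|/(allP uP) vP]; apply: face_outer => //; exact: port_face.
- by rewrite lu; apply: port_face.
- by [].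
exists s; rewrite /= (p0 d a) (p0 d' b) -lu; split=> //.
- by move=> v /h3[? _ _].
- by move=> _; have := h4 (expn_scale_gt0 n); rewrite expnSr /= su.
Qed.

(** The last digits of [v] lie in the nets named by [I]. As the nets are disjoint, [v] determines
    the word, so routes with different words of the same length are disjoint. *)
Fixpoint labelled I v : Prop :=
  if I is i :: I' then net i ((v %/ P ^ size I') %% P) /\ labelled I' v else True.

Lemma labelled_inj I J v : size I = size J -> labelled I v -> labelled J v -> I = J.
Proof.
elim: I J => [|i I IH] [|j J] //= [e] [ni lI] [nj lJ].
by rewrite (IH J) //; congr cons; move: nj; rewrite -e => /(net_inj ni).
Qed.

Definition net_index I := all (fun i => 0 < i <= width S) I.

Lemma net_index_wire I : net_index I -> wire_index I.
Proof. by apply: sub_all => i /andP[]. Qed.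

Lemma net_cross I q d d' a b : net_index I -> d <> d' ->
  exists s, [/\ path adjn (wire q d a I) s,
    last (wire q d a I) s = wire q d' b I,
    forall v, v \in wire q d a I :: s -> v %/ P ^ size I = q /\ labelled I v
    & 0 < 0 -> size s < 0].
Proof.
elim: I q d d' a b => [|i I IH] q d d' a b /=.
  move=> _ _; exists [::]; split=> //= v; rewrite inE => /eqP->.
  by rewrite expn0 divn1.
case/andP=> iw Iw dd'.
have [us0 [pu0 lu0 hu0]] := net_path d a d' b iw.
case: (shortenP pu0) lu0 => us pu uu sub lu.
have iw' : i <= width S by case/andP: iw.
have hu v : v \in port S d a i :: us -> v < P /\ net i v.
  by rewrite inE => /orP[/eqP->|/sub vin]; apply: hu0; rewrite ?mem_head // inE vin orbT.
have [|||||s [h1 h2 h3 h4]] := @digit_chain I (labelled I) 0 (net_index_wire Iw) _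
    q _ us d a d' b pu uu.
- by move=> *; apply: IH.
- by move=> v /hu[].
- move=> v /hu[vP _]; apply: face_outer => //; [exact: port_lt|exact: port_face].
- by rewrite lu; apply: port_face.
- by [].
exists s; rewrite -lu; split=> // v /h3[h5 h6 h7]; split=> //; split=> //.
by case: (hu _ h6).
Qed.

Lemma size_digits us : uniq us -> (forall v, v \in us -> v < P) -> size us <= P.
Proof.
move=> uu uP; rewrite -[X in _ <= X](size_iota 0); apply: uniq_leq_size => // v.
by rewrite mem_iota; apply: uP.
Qed.

(** Leaving the subcopy of [x] costs [P * L ^ n] by induction, and at most [P] further subcopies are
    crossed at a cost of [L ^ n] each; the resulting factor 2 is absorbed by [2 <= L]. *)
Lemma path_to_wire n x d a : exists s,
  [/\ path adjn x s, last x s = wire (x %/ P ^ n) d a (nseq n 0)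
    & size s <= P * L ^ n].
Proof.
elim: n d a => [|n IH] d a; first by exists [::]; rewrite expn0 divn1.
have L2 : L ^ n * 2 <= L ^ n.+1 by rewrite expnSr leq_mul2l scale_gt1 orbT.
rewrite divn_expnS /=; set X := x %/ P ^ n; set q := X %/ P.
have uP : X %% P < P by rewrite ltn_mod base_gt0.
have pP : port S d a 0 < P by exact: port_lt.
have [us0 [pu0 lu0 hu0]] := digit_path uP pP.
case: (shortenP pu0) lu0 => us pu uu sub lu.
have us_lt v : v \in us -> v < P by move=> /sub/(allP hu0).
case: us pu uu lu us_lt {sub} => [|u1 us] /=.
  move=> _ _ E _; have [s [h1 h2 h3]] := IH d a.
  exists s; split=> //; first by rewrite h2 -E -divn_eq.
  by apply: leq_trans h3 _; rewrite leq_mul2l; lia.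
case/andP=> /touchP[f uu1] pu /andP[nu uus] lu us_lt.
have u1P : u1 < P by apply: us_lt; rewrite mem_head.
have XX1 : C f X (q * P + u1) by rewrite (divn_eq X P); apply/contact_local.
have [a1 [b1 t1]] := contact_typed XX1.
have [s [h1 h2 h3]] := IH f a1.
have c1 := contact_sym uu1.
have [||||s' [k1 k2 _ k4]] := @digit_chain (nseq n 0) (fun=> True) (L ^ n)
    (nseq0_index n) (@centre_cross n) q u1 us (opp f) b1 d a pu uus.
- exact: us_lt.
- by move=> v vin /(contact_inj c1) E; move: nu; rewrite E vin.
- by rewrite lu; apply: port_face.
- move=> E ed; apply: (@face_outer S d u1 (X %% P)) => //; last by rewrite -ed.
  by move: lu; rewrite E => /= ->; apply: port_face.
exists (s ++ wire (q * P + u1) (opp f) b1 (nseq n 0) :: s'); split.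
- rewrite cat_path h1 h2 /= k1 andbT; apply/touchP; exists f.
  exact: tcontactW (wire_tcontact (nseq0_index n) t1).
- by rewrite last_cat /= k2 lu.
have := k4 (expn_scale_gt0 n); rewrite size_cat /=.
have : size (u1 :: us) <= P by apply: size_digits.
move=> /= h5 h6; apply: leq_trans (_ : P * (L ^ n * 2) <= _); last by rewrite leq_mul2l L2 orbT.
have : L ^ n * (size us).+1 <= L ^ n * P by rewrite leq_mul2l h5 orbT.
rewrite mulnA muln2 -addnn [L ^ n * P]mulnC => h7.
exact: leq_add h3 (leq_trans h6 h7).
Qed.

Definition linked x y := exists s, path adjn x s /\ last x s = y.

Lemma touch_irr : irreflexive adjn.
Proof. by move=> x; apply/negP => /touchP[d /contact_irr]. Qed.

Lemma linked_sym x y : linked x y -> linked y x.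
Proof.
move=> [s [xs <-]]; exists (rev (belast x s)); split.
  by rewrite rev_path (@eq_path _ _ adjn) // => u v; rewrite touch_sym.
by case: s {xs} => //= u s; rewrite rev_cons last_rcons.
Qed.

Lemma touch_connected x y : linked x y.
Proof.
(* All numbers up to [n] are below [P ^ n], hence lie in the copy 0 of level [n]. *)
pose n := maxn x y; pose w := wire 0 (ord0, true) true (nseq n 0).
have to_w z : z <= n -> linked z w.
  move=> zn; have zP : z < P ^ n by apply: leq_ltn_trans zn (ltn_expl _ (base_gt1 S)).
  have [s [zs ls _]] := path_to_wire n z (ord0, true) true.
  by exists s; rewrite ls divn_small.
have [s [xs ls]] := to_w x (leq_maxl x y).
have [t [wt lt]] := linked_sym (to_w y (leq_maxr x y)).
by exists (s ++ t); rewrite cat_path xs ls wt last_cat ls.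
Qed.

Lemma nat_inhabited : exists x : nat, True.
Proof. by exists 0. Qed.

Definition graph : connected_graph :=
  @ConnectedGraph nat adjn touch_sym touch_irr nat_inhabited touch_connected.

End Substitution.

(** * Growth and disjoint paths *)

Lemma card_fset_set_le (T : choiceType) (A : set T) (s : seq T) :
  (forall x, A x -> x \in s) ->
  finite_set A /\ (#|` fset_set A| <= size s)%N.
Proof.
move=> As; have fA : finite_set A by apply: sub_finite_set (finite_seq s).
split=> //; apply: uniq_leq_size => // x.
by rewrite in_fset_set // => /set_mem/As.
Qed.

Lemma card_fset_set_ge (T : choiceType) (A : set T) (s : seq T) :
  finite_set A -> uniq s -> (forall x, x \in s -> A x) ->
  (size s <= #|` fset_set A|)%N.
Proof.
move=> fA us sA; apply: uniq_leq_size => // x xs.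
by rewrite in_fset_set //; apply/mem_set/sA.
Qed.

Section Metric.
Variable S : substitution.
Local Notation P := (base S).
Local Notation L := (scale S).
Local Notation C := (@contact S).
Local Notation adjn := (@touch S).
Local Notation G := (graph S).
Local Open Scope nat_scope.

(** The copy containing [x] and at most one neighbour in each of the six directions. *)
Lemma ball_copies n (x : G) : exists l : seq nat, size l = 7 /\
  forall y : G, (gdist x y).+1 < L ^ n -> y %/ P ^ n \in l.
Proof.
pose q := x %/ P ^ n.
exists (q :: [seq xget 0 [set q' | C d q q'] | d : dir]); split.
  by rewrite /= size_map -cardE card_prod card_ord card_bool.
move=> y; have [s [xs <- <-]] := gdist_path x y => Ln.
have [->|[f Cf]] := short_path_copy xs Ln; first exact: mem_head.
rewrite inE; apply/orP; right; apply/mapP; exists f; first by rewrite mem_enum.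
case: xgetP => [z _ /= Cz|/(_ _ Cf)//].
exact: contact_inj Cf Cz.
Qed.

Lemma copy_diameter n (x y : G) : x %/ P ^ n = y %/ P ^ n ->
  gdist x y <= 2 * P * L ^ n.
Proof.
move=> xy; have le (z : G) :
    gdist z (wire S (z %/ P ^ n) (ord0, true) true (nseq n 0) : G) <= P * L ^ n.
  have [s [zs ls]] := path_to_wire S n z (ord0, true) true.
  by apply: leq_trans; apply: (@gdist_le_size G) zs ls.
apply: leq_trans (gdist_triangle x (wire S (x %/ P ^ n) (ord0, true) true (nseq n 0) : G) y) _.
by rewrite -mulnA mul2n -addnn leq_add // gdist_sym xy.
Qed.

(** The largest level with [2 * P * L ^ n <= m]; for [m < 2 * P] it is level 0, whose copies are
    single vertices. *)
Lemma copy_in_ball m : exists n, m < 2 * P * L ^ n.+1 /\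
  forall x y : G, x %/ P ^ n = y %/ P ^ n -> gdist x y <= m.
Proof.
have P2 : 0 < 2 * P by rewrite muln_gt0 base_gt0.
have [mP|mP] := ltnP m (2 * P).
  exists 0; split; last by move=> x y; rewrite expn0 !divn1 => ->; rewrite gdistxx.
  by rewrite (leq_trans mP) // expn1 leq_pmulr // ltnW ?scale_gt1.
have t0 : 0 < m %/ (2 * P) by rewrite divn_gt0.
have /andP[le lt] := trunc_log_bounds (scale_gt1 S) t0.
exists (trunc_log L (m %/ (2 * P))); split.
  by rewrite [2 * P * _]mulnC -ltn_divLR.
move=> x y /copy_diameter xy; apply: leq_trans xy _.
by rewrite [2 * P * _]mulnC -leq_divRL.
Qed.

Lemma copy_iota n q : forall y, (y \in iota (q * P ^ n) (P ^ n)) = (y %/ P ^ n == q).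
Proof.
move=> y; have a0 := expn_base_gt0 S n; set a := P ^ n in a0 *.
by rewrite mem_iota eqn_leq -[y %/ a <= q]ltnS ltn_divLR // leq_divRL // mulSnr andbC.
Qed.

Lemma labelled_wire I q d a : net_index S I -> labelled S I (wire S q d a I).
Proof.
move=> Iw; have [s [_ _ h _]] := net_cross q a a Iw (@opp_neq (opp d)).
by rewrite oppK in h; have [] := h _ (mem_head _ _).
Qed.

(** In the first and in the last copy the route has a single vertex, at the face towards its
    neighbour; only the copies in between are crossed. *)
Lemma labelled_route I q q1 qs : net_index S I ->
  path adjn q (q1 :: qs) -> uniq (q :: q1 :: qs) ->
  exists v s, [/\ path adjn v s, v %/ P ^ size I = q,
    last v s %/ P ^ size I = last q1 qs
    & forall u, u \in v :: s -> labelled S I u].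
Proof.
move=> Iw; have Iw' := net_index_wire Iw.
rewrite /= => /andP[/touchP[f qq1] pqs] uqs.
have [a [b t]] := contact_typed qq1.
have c1 := contact_sym qq1.
have st : adjn (wire S q f a I) (wire S q1 (opp f) b I).
  by apply/touchP; exists f; apply: tcontactW (wire_tcontact Iw' t).
exists (wire S q f a I).
case/lastP: qs pqs uqs => [|qs q2] pqs uqs.
  exists [:: wire S q1 (opp f) b I]; rewrite /= st !wire_copy //; split=> // u.
  by rewrite !inE => /orP[] /eqP->; apply: labelled_wire.
move: pqs uqs; rewrite -cons_uniq -!rcons_cons rcons_path rcons_uniq.
move=> /andP[pqs /touchP[g lq2]] /andP[].
rewrite inE negb_or => /andP[q2q q2qs] /= /andP[qqs uqs].
have [a2 [b2 t2]] := contact_typed lq2.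
have [||||s [h1 h2 h3 _]] := @chain S I (labelled S I) 0 Iw' _ q1 qs (opp f) b g a2 pqs uqs.
- by move=> *; apply: net_cross.
- by move=> q' q'in /(contact_inj c1) E; move: qqs; rewrite E q'in.
- by move=> q' q'in /(contact_inj lq2) E; move: q2qs; rewrite E q'in.
- move=> E fg; move: q2q; rewrite E /= in lq2; rewrite -fg in lq2.
  by rewrite (contact_inj lq2 c1) eqxx.
exists (wire S q1 (opp f) b I :: rcons s (wire S q2 (opp g) b2 I)); split.
- rewrite /= st rcons_path h1 h2 /=; apply/touchP; exists g.
  exact: tcontactW (wire_tcontact Iw' t2).
- exact: wire_copy.
- by rewrite /= !last_rcons wire_copy.
move=> u; rewrite inE => /orP[/eqP->|]; first exact: labelled_wire.
rewrite -rcons_cons mem_rcons inE => /orP[/eqP->|/h3[]//]; exact: labelled_wire.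
Qed.

Lemma ball_bounded m (x : G) : exists b, forall y : G, gdist x y <= m -> y < b.
Proof.
have lt : m.+1 < L ^ m.+2 by apply: ltn_trans (ltnSn _) (ltn_expl _ (scale_gt1 S)).
have [l [_ hl]] := ball_copies m.+2 x.
exists (\max_(q <- l) (q.+1 * P ^ m.+2)) => y ym.
have := hl y (leq_ltn_trans _ lt); rewrite ltnS => /(_ ym) yl.
apply: (@leq_trans ((y %/ P ^ m.+2).+1 * P ^ m.+2)).
  by rewrite -ltn_divLR ?expn_base_gt0.
exact: (@leq_bigmax_seq _ _ xpredT (fun q => q.+1 * P ^ m.+2)).
Qed.

(** A ball is a bounded set of numbers, and the number of a copy is at most that of each of its
    vertices. So it suffices to head for a copy with a large number. *)
Lemma labelled_route_far I (x : G) m : net_index S I ->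
  exists (v : G) (s : seq G), [/\ path (@adj G) v s, v %/ P ^ size I = x %/ P ^ size I,
    m <= gdist x (last v s) & forall u, u \in v :: s -> labelled S I u].
Proof.
move=> Iw; have [b hb] := ball_bounded m x.
set q := x %/ P ^ size I; pose q2 := maxn b q.+1.
have [s0 [p0 l0]] := touch_connected S q q2.
case: (shortenP p0) l0 => s p us _ l0.
case: s p us l0 => [|q1 qs] p us l0.
  by have := leq_maxr b q.+1; rewrite -/q2 -l0 ltnn.
have [v [s [h1 h2 h3 h4]]] := labelled_route Iw p us.
exists v, s; split=> //; rewrite leqNgt; apply/negP => /ltnW/hb; apply/negP.
rewrite -leqNgt (leq_trans (leq_maxl b q.+1)) // -/q2 -l0 /= -h3.
exact: leq_div.
Qed.

End Metric.

Section Growth.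
Variables (R : realType) (S : substitution).
Local Notation P := (base S).
Local Notation L := (scale S).
Local Notation G := (graph S).

Let L_gt0 : 0 < L%:R :> R.
Proof. by rewrite ltr0n scale_gt0. Qed.

Lemma powR_natX (a b : R) n : 0 <= a -> (a ^+ n) `^ b = (a `^ b) ^+ n.
Proof. by move=> a0; rewrite -powR_mulrn // -powRrM mulrC powRrM powR_mulrn ?powR_ge0. Qed.

(** The exponent is chosen so that a copy of level [n] has [P ^ n = (L ^ n) ^ k] vertices. A ball is
    covered by seven copies of level [n] with [L ^ n] comparable to [r], and contains one copy of
    such a size. *)
Theorem substitution_growth (k : R) : 1 <= k -> L%:R `^ k = P%:R ->
  uniform_polynomial_growth G k.
Proof.
move=> k1 Lk; split=> //.
have k0 : 0 <= k by apply: le_trans k1.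
pose c : R := (2 * P * L)%:R.
have c1 : 1 <= c by rewrite ler1n !muln_gt0 base_gt0 scale_gt0.
have c0 : 0 <= c by apply: le_trans c1.
have ck1 : 1 <= c `^ k.
  have {1}-> : 1 = 1 `^ k :> R by rewrite powR1.
  by apply: ge0_ler_powR; rewrite ?nnegrE.
exists (7 * c `^ k); split.
  by apply: le_trans ck1 _; rewrite ler_peMl ?ler1n ?powR_ge0.
move=> x r r1; have r0 : 0 <= r by apply: le_trans r1.
pose m := Num.truncn r.
have mr : m%:R <= r by rewrite truncn_le.
have rm : r < m.+1%:R by rewrite truncnS_gt.
have Pn n : (P ^ n)%:R = (L ^ n)%:R `^ k :> R.
  by rewrite !natrX powR_natX ?ltW // Lk.
have [n [le1 le2]] : exists n, (m.+1 < L ^ n)%N /\ (L ^ n <= L * m.+1)%N.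
  have /andP[h1 h2] := trunc_log_bounds (scale_gt1 S) (ltn0Sn m).
  by exists (trunc_log L m.+1).+1; rewrite h2 expnS leq_mul2l h1 orbT.
have [l [sl hl]] := ball_copies n x.
pose cover := flatten [seq iota (q * P ^ n) (P ^ n) | q <- l].
have cov y : gball x r y -> y \in cover.
  rewrite /gball /= => xy; apply/flattenP; exists (iota (y %/ P ^ n * P ^ n) (P ^ n)).
    apply/map_f/hl; apply: leq_ltn_trans le1; rewrite ltnS.
    by rewrite truncn_ge_nat.
  by rewrite copy_iota.
have [fin up] := card_fset_set_le cov.
split=> //; last first.
  apply: le_trans (_ : (7 * P ^ n)%:R <= _).
    rewrite ler_nat; apply: leq_trans up _; rewrite size_flatten /shape -map_comp.
    rewrite (eq_map (g := fun=> P ^ n)%N); last by move=> q /=; rewrite size_iota.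
    by rewrite sumnE big_map big_const_seq count_predT iter_addn_0 sl mulnC.
  rewrite natrM -mulrA ler_pM2l ?ltr0n // Pn -powRM // ge0_ler_powR ?nnegrE ?ler0n ?mulr_ge0 //.
  apply: le_trans (_ : (L * m.+1)%:R <= _); first by rewrite ler_nat.
  apply: le_trans (_ : (L * 2)%:R * r <= _).
    rewrite !natrM -mulrA ler_pM2l //; move: mr; rewrite -natr1; lra.
  by rewrite ler_wpM2r // ler_nat mulnC leq_mul2r leq_pmulr ?base_gt0 ?orbT.
have [n' [h1 h2]] := copy_in_ball S m.
have lo : (P ^ n' <= #|` fset_set (gball x r)|)%N.
  rewrite -{1}(size_iota (x %/ P ^ n' * P ^ n') (P ^ n')).
  apply: card_fset_set_ge (iota_uniq _ _) _ => // y.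
  rewrite copy_iota => /eqP xy; rewrite /gball /=.
  by apply: le_trans mr; rewrite ler_nat h2.
apply: le_trans (_ : (P ^ n')%:R <= _); last by rewrite ler_nat.
rewrite invfM -mulrA -[leRHS]mul1r ler_pM ?mulr_ge0 ?invr_ge0 ?ler0n ?powR_ge0 //.
  by rewrite invf_le1 ?ler1n ?ltr0n.
rewrite mulrC ler_pdivrMr ?(lt_le_trans ltr01) // Pn mulrC -powRM // ge0_ler_powR ?nnegrE ?mulr_ge0 //.
by rewrite -natrM (le_trans (ltW rm)) // ler_nat (leq_trans h1) // expnS mulnA.
Qed.

(** The copy of [x] of the largest level [n] fitting into the ball of radius [r] emits one route for
    each of the [width ^ n] words of length [n]. This number is at least [(L ^ n) ^ s], and [L ^ n]
    is at least [r] up to a constant. *)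
Theorem substitution_disjoint_paths (s : R) : 0 <= s ->
  L%:R `^ s <= (width S)%:R ->
  exists c : R, 0 < c /\ forall (x : G) (r r' : nat), (r < r')%N ->
    exists (n : nat) (p : 'I_n -> seq G),
      c * r%:R `^ s <= n%:R /\
      disjoint_paths (gsphere x r) (gsphere x r') p.
Proof.
move=> s0 Ls; pose c : R := (2 * P * L)%:R.
have c_gt0 : 0 < c by rewrite ltr0n !muln_gt0 base_gt0 scale_gt0.
exists (c `^ s)^-1; rewrite invr_gt0 powR_gt0 //; split=> // x r r' rr'.
have [n [h1 h2]] := copy_in_ball S r.
pose wires (i : n.-tuple 'I_(width S)) := [seq (nat_of_ord j).+1 | j <- i].
have size_wires i : size (wires i) = n by rewrite size_map size_tuple.
have net_wires i : net_index S (wires i).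
  by apply/allP => _ /mapP[j _ ->] /=.
have wires_inj : injective wires.
  by move=> i j /inj_map ij; apply/val_inj/ij => a b [/val_inj].
have route i : exists p, path_from_to (gsphere x r) (gsphere x r') p /\
    {in p, forall v, labelled S (wires i) v}.
  have [v [t [vt vx far lab]]] := labelled_route_far x r' (net_wires i).
  have [] := path_between_spheres (o := x) (a := r) (b := r') vt _ (ltnW rr') far.
    by apply: h2; rewrite -(size_wires i) vx.
  by move=> p [pxy sub]; exists p; split=> // u /sub/lab.
pose p i := projT1 (cid (route i)).
have p_path i : path_from_to (gsphere x r) (gsphere x r') (p i).
  by rewrite /p; case: cid => ? [].
have p_lab i : {in p i, forall v, labelled S (wires i) v}.
  by rewrite /p; case: cid => ? [].
exists #|{: n.-tuple 'I_(width S)}|, (fun i => p (enum_val i)); split; last first.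
  split=> // i j ij v [vi vj]; apply: ij; apply: enum_val_inj; apply: wires_inj.
  by apply: (labelled_inj _ (p_lab _ _ vi) (p_lab _ _ vj)); rewrite !size_wires.
rewrite card_tuple card_ord natrX mulrC ler_pdivrMr ?powR_gt0 //.
apply: le_trans (_ : (c * (L ^ n)%:R) `^ s <= _).
  rewrite ge0_ler_powR ?nnegrE ?mulr_ge0 // ?ltW //.
  by rewrite /c -natrM ltr_nat -mulnA -expnS.
rewrite powRM ?(ltW c_gt0) ?ler0n // mulrC ler_wpM2r ?powR_ge0 // natrX powR_natX ?(ltW L_gt0) //.
by rewrite lerXn2r ?nnegrE ?powR_ge0.
Qed.

End Growth.

(** * Cubes replaced by cubes *)

Lemma ord3P (k l : 'I_3) : [\/ l = k, l = k + 1 | l = k + 2].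
Proof.
by case: k l => [[|[|[|//]]] ?] [[|[|[|//]]] ?];
  (constructor 1; exact/val_inj) || (constructor 2; exact/val_inj)
  || (constructor 3; exact/val_inj).
Qed.

Lemma ord3_neq (k : 'I_3) : [/\ k + 1 <> k, k + 2 <> k & k + 1 <> k + 2].
Proof. by case: k => [[|[|[|//]]] ?]; split=> /(congr1 val). Qed.

Definition sgd (d : dir) : int := if d.2 then -1 else 1.

Lemma sgd_opp d : sgd (opp d) = - sgd d.
Proof. by case: d => k []; rewrite /sgd ?opprK. Qed.

(* Centre and side of an axis-parallel cube. *)
Definition cell : Type := ({ffun 'I_3 -> int} * int)%type.

Section Cubes.
Variable F : realFieldType.
Implicit Types (p q : 'I_3 -> F) (s t : F).

(** Twice the displacement of the centres in direction [d], to be compared with the sum of the two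
    sides. *)
Definition gap (d : dir) p q : F := 2 * (sgd d)%:~R * (q d.1 - p d.1).

Definition facing d p s q t : Prop :=
  gap d p q = s + t /\ forall k, k <> d.1 -> q k = p k.

(* In the last case the cubes may share an edge; like disjointness, this
   excludes tangency and is inherited by the cubes inside them. *)
Definition separated d p s q t (comparable : Prop) : Prop :=
  [\/ facing d p s q t /\ comparable, s + t < gap d p q
    | exists e, [/\ e.1 <> d.1, s + t <= gap d p q & s + t <= gap e p q]].

Lemma gap_opp d p q : gap (opp d) q p = gap d p q.
Proof. by rewrite /gap sgd_opp /= mulrNz; ring. Qed.

Lemma facing_sym d p s q t : facing d p s q t -> facing (opp d) q t p s.
Proof. by move=> [g l]; split=> [|k /l//]; rewrite gap_opp g addrC. Qed.

(** Sideways the centres agree, and backwards the gap is negative. So the direction of contact is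
    the only one in which facing cubes are separated. *)
Lemma facing_gap d p s q t e : 0 < s -> 0 < t -> facing d p s q t ->
  e <> d -> gap e p q < s + t.
Proof.
move=> s0 t0 [g l] ed.
have [E|/eqP/l E] := eqVneq e.1 d.1; last by rewrite /gap E subrr mulr0 addr_gt0.
have -> : e = opp d by case: e d E ed {g l} => [k []] [k' []] /= -> //; rewrite /opp.
have -> : gap (opp d) p q = - gap d p q by rewrite /gap sgd_opp /= mulrNz; ring.
by rewrite g; lra.
Qed.

End Cubes.

(** * Gadgets with integer coordinates *)

Section Layout.

Definition igap (d : dir) (u v : cell) : int := 2 * sgd d * (v.1 d.1 - u.1 d.1).

Definition ifacing d (u v : cell) : Prop :=
  igap d u v = u.2 + v.2 /\ forall k, k <> d.1 -> v.1 k = u.1 k.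

Definition comparable (r a b : int) := [\/ a = b, a = r * b | r * a = b].

Definition iseparated r d (u v : cell) : Prop :=
  [\/ ifacing d u v /\ comparable r u.2 v.2, u.2 + v.2 < igap d u v
    | exists e, [/\ e.1 <> d.1, u.2 + v.2 <= igap d u v & u.2 + v.2 <= igap e u v]].

(* [reach d u] is twice the coordinate of the face of [u] in direction [d]. *)
Definition reach (d : dir) (u : cell) : int := 2 * sgd d * u.1 d.1 + u.2.

Definition hub (h : int) : cell := ([ffun=> 0], h).

End Layout.

(** What a gadget must satisfy for repeated substitution to give a packing. The hub is the first
    cell, hence the digit 0. By [at_face], all faces carry unit cells on one line at multiples of
    the ratio, so any two faces can be brought together. *)
Record layout := Layout {
  ratio : int;
  box : int;
  hubside : int;
  others : seq cell;
  cells := hub hubside :: others;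
  ratio_gt1 : 1 < ratio;
  cells_uniq : uniq cells;
  cells_gt1 : (0 < size others)%N;
  side_gt0 : forall u, u \in cells -> 0 < u.2;
  in_box : forall u d, u \in cells -> reach d u <= box;
  at_face : forall u d, u \in cells -> reach d u = box ->
    [/\ u.2 = 1, u.1 (d.1 + 2) = 0 & (ratio %| u.1 (d.1 + 1)%R)%Z];
  cells_separated : forall u v, u \in cells -> v \in cells -> u <> v ->
    exists d, iseparated ratio d u v }.

Section Realization.
Variables (F : realFieldType) (T : layout).
Local Notation r := (ratio T).
Local Notation N := (box T).
Local Notation H := (hubside T).
Local Notation P := (size (cells T)).

Definition digit (u : nat) : cell := nth (hub H) (cells T) u.

(** A cube of side s is enlarged by the factor box / hubside and filled with the gadget scaled by s
    / hubside. With this normalization the cube 0 is its own hub, so leading zeros change nothing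
    and the number of digits read is immaterial once it is large enough; [x] digits suffice. *)
Fixpoint size_upto (n x : nat) : F := if n is n'.+1 then
  size_upto n' (x %/ P)%N * ((digit (x %% P)%N).2)%:~R / H%:~R else 1.

Fixpoint centre_upto (n x : nat) k : F := if n is n'.+1 then
  (N%:~R * centre_upto n' (x %/ P)%N k +
   size_upto n' (x %/ P)%N * ((digit (x %% P)%N).1 k)%:~R) / H%:~R else 0.

Definition side (x : nat) := size_upto x x.
Definition centre (x : nat) := centre_upto x x.

Lemma P_gt1 : (1 < P)%N.
Proof. exact: cells_gt1. Qed.

Lemma P_gt0 : (0 < P)%N.
Proof. exact: ltnW P_gt1. Qed.

Lemma digit_in u : (u < P)%N -> digit u \in cells T.
Proof. exact: mem_nth. Qed.

Lemma digit_inj u v : (u < P)%N -> (v < P)%N -> digit u = digit v -> u = v.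
Proof. by move=> uP vP /eqP; rewrite nth_uniq ?cells_uniq // => /eqP. Qed.

Lemma H_gt0 : 0 < H%:~R :> F.
Proof. by rewrite ltr0z (@side_gt0 T (hub H)) ?mem_head. Qed.

Lemma upto0 n k : size_upto n 0 = 1 /\ centre_upto n 0 k = 0.
Proof.
elim: n => [|n [IHs IHc]] //=; rewrite ?div0n ?mod0n IHs IHc /digit /= ffunE.
by rewrite mul1r divff ?gt_eqF ?H_gt0 // !mulr0 addr0 mul0r.
Qed.

Lemma upto_stable m n x k : (x < P ^ m)%N -> (x < P ^ n)%N ->
  size_upto m x = size_upto n x /\ centre_upto m x k = centre_upto n x k.
Proof.
elim: m n x => [|m IH] n x; first by rewrite ltnS leqn0 => /eqP-> _; have [-> ->] := upto0 n k.
case: n => [|n] xm.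
  by rewrite ltnS leqn0 => /eqP->; have [-> ->] := upto0 m.+1 k.
move=> xn /=; have [||-> ->] // := IH n (x %/ P)%N.
  by rewrite ltn_divLR ?P_gt0 // -expnSr.
by rewrite ltn_divLR ?P_gt0 // -expnSr.
Qed.

Lemma childP q u : (u < P)%N -> [/\ (q * P + u < P ^ (q * P + u).+1)%N,
  (q * P + u < P ^ (q * P + u))%N, (q < P ^ (q * P + u))%N,
  ((q * P + u) %/ P)%N = q & ((q * P + u) %% P)%N = u].
Proof.
move=> uP; have lt n : (n < P ^ n)%N by apply: ltn_expl P_gt1.
split=> //.
- exact: ltn_trans (ltnSn _) (lt _).
- apply: leq_ltn_trans (lt _).
  by rewrite (leq_trans _ (leq_addr _ _)) ?leq_pmulr ?P_gt0.
- by rewrite divnMDl ?P_gt0 // divn_small // addn0.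
- by rewrite modnMDl modn_small.
Qed.

Lemma child_size q u : (u < P)%N ->
  side (q * P + u)%N = side q * ((digit u).2)%:~R / H%:~R.
Proof.
move=> /(childP q)[lt1 lt2 lt3 div mod]; rewrite /side.
have [-> _] := upto_stable ord0 lt2 lt1.
by rewrite /= div mod; have [-> _] := upto_stable ord0 lt3 (ltn_expl q P_gt1).
Qed.

Lemma child_centre q u k : (u < P)%N ->
  centre (q * P + u)%N k =
  (N%:~R * centre q k + side q * ((digit u).1 k)%:~R) / H%:~R.
Proof.
move=> /(childP q)[lt1 lt2 lt3 div mod]; rewrite /side /centre.
have [_ ->] := upto_stable k lt2 lt1.
by rewrite /= div mod; have [-> ->] := upto_stable k lt3 (ltn_expl q P_gt1).
Qed.

Lemma side_gt0R x : 0 < side x.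
Proof.
rewrite /side; move: {1}x => n; elim: n x => [|n IH] x //=.
rewrite divr_gt0 ?H_gt0 ?mulr_gt0 ?IH // ltr0z.
by rewrite (@side_gt0 T) // digit_in // ltn_mod P_gt0.
Qed.

Lemma child_gap d q u q' v : (u < P)%N -> (v < P)%N ->
  gap d (centre (q * P + u)%N) (centre (q' * P + v)%N) =
  (N%:~R * gap d (centre q) (centre q') +
   2 * (sgd d)%:~R * (side q' * ((digit v).1 d.1)%:~R
                      - side q * ((digit u).1 d.1)%:~R)) / H%:~R.
Proof.
move=> uP vP; rewrite /gap !child_centre //.
by rewrite -mulrBl mulrA; congr (_ / _); ring.
Qed.

(* The gap between two cubes splits into the gap between their parents and the
   two gaps between the cubes and the faces of their parents. *)
Lemma child_gapE d q u q' v : (u < P)%N -> (v < P)%N ->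
  H%:~R * (gap d (centre (q * P + u)%N) (centre (q' * P + v)%N)
           - (side (q * P + u)%N + side (q' * P + v)%N)) =
  N%:~R * (gap d (centre q) (centre q') - (side q + side q')) +
  side q * (N - reach d (digit u))%:~R + side q' * (N - reach (opp d) (digit v))%:~R.
Proof.
move=> uP vP; rewrite child_gap // !child_size // /reach sgd_opp /=.
rewrite !(rmorphB, rmorphD, rmorphM, rmorphN) /=.
by field; rewrite gt_eqF ?H_gt0.
Qed.

Definition sim (s t : F) := [\/ s = t, s = r%:~R * t | r%:~R * s = t].

Definition sep d x y := separated d (centre x) (side x) (centre y) (side y)
  (sim (side x) (side y)).

Lemma child_reach d u : (u < P)%N -> 0 <= (N - reach d (digit u))%:~R :> F.
Proof. by move=> uP; rewrite ler0z subr_ge0 in_box ?digit_in. Qed.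

Lemma child_reach_lt d u : (u < P)%N -> reach d (digit u) <> N ->
  0 < (N - reach d (digit u))%:~R :> F.
Proof.
move=> uP nN; rewrite ltr0z subr_gt0 lt_neqAle in_box ?digit_in // andbT.
exact/eqP.
Qed.

Lemma box_ge0 : 0 <= N%:~R :> F.
Proof.
have := @in_box T (hub H) (ord0, true) (mem_head _ _).
rewrite /reach ffunE mulr0 add0r ler0z; apply: le_trans.
by have := H_gt0; rewrite ltr0z => /ltW.
Qed.

(** * Cubes with different parents *)

Section Children.
Variables (d : dir) (q u q' v : nat).
Hypotheses (uP : (u < P)%N) (vP : (v < P)%N).
Local Notation x := (q * P + u)%N.
Local Notation y := (q' * P + v)%N.

Lemma child_gap_le : side q + side q' <= gap d (centre q) (centre q') ->
  side x + side y <= gap d (centre x) (centre y).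
Proof.
move=> g; rewrite -subr_ge0 -(pmulr_rge0 _ H_gt0) child_gapE //.
by rewrite !addr_ge0 ?mulr_ge0 ?child_reach ?box_ge0 ?(ltW (side_gt0R _)) // subr_ge0.
Qed.

Lemma child_gap_lt : side q + side q' < gap d (centre q) (centre q') ->
  side x + side y < gap d (centre x) (centre y).
Proof.
move=> g; rewrite -subr_gt0 -(pmulr_rgt0 _ H_gt0) child_gapE // -addrA.
rewrite ltr_wpDr // ?addr_ge0 ?mulr_ge0 ?child_reach ?(ltW (side_gt0R _)) //.
rewrite mulr_gt0 ?subr_gt0 // lt_neqAle box_ge0 andbT eq_sym intr_eq0.
apply/eqP => N0; have := @in_box T (hub H) (ord0, true) (mem_head _ _).
rewrite /reach ffunE mulr0 add0r N0 leNgt.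
by have := H_gt0; rewrite ltr0z => ->.
Qed.

Lemma child_gap_eq : side q + side q' = gap d (centre q) (centre q') ->
  reach d (digit u) = N -> reach (opp d) (digit v) = N ->
  gap d (centre x) (centre y) = side x + side y.
Proof.
move=> g ru rv; have /eqP := child_gapE d q q' uP vP.
rewrite g subrr ru rv subrr !mulr0 !addr0 mulf_eq0 gt_eqF ?H_gt0 //=.
by rewrite subr_eq0 => /eqP.
Qed.

Lemma child_gap_away : side q + side q' = gap d (centre q) (centre q') ->
  reach d (digit u) <> N \/ reach (opp d) (digit v) <> N ->
  side x + side y < gap d (centre x) (centre y).
Proof.
move=> g away; rewrite -subr_gt0 -(pmulr_rgt0 _ H_gt0) child_gapE //.
rewrite g subrr mulr0 add0r; case: away => n.
  by rewrite ltr_wpDr ?mulr_gt0 ?mulr_ge0 ?child_reach_lt ?child_reach ?(ltW (side_gt0R _)) ?side_gt0R.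
by rewrite ltr_wpDl ?mulr_gt0 ?mulr_ge0 ?child_reach_lt ?child_reach ?(ltW (side_gt0R _)) ?side_gt0R.
Qed.

Hypothesis (qq' : facing d (centre q) (side q) (centre q') (side q')).
Hypotheses (ru : reach d (digit u) = N) (rv : reach (opp d) (digit v) = N).

Lemma child_sides : side x = side q / H%:~R /\ side y = side q' / H%:~R.
Proof.
have [su _ _] := at_face (digit_in uP) ru.
have [sv _ _] := at_face (digit_in vP) rv.
by rewrite !child_size // su sv !mulr1.
Qed.

Lemma child_lateral k : k <> d.1 -> centre y k - centre x k =
  (side q' * ((digit v).1 k)%:~R - side q * ((digit u).1 k)%:~R) / H%:~R.
Proof. by move=> kd; rewrite !child_centre // (qq'.2 k kd) -mulrBl; congr (_ / _); ring. Qed.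

Lemma child_facing :
  side q * ((digit u).1 (d.1 + 1))%:~R = side q' * ((digit v).1 (d.1 + 1))%:~R ->
  facing d (centre x) (side x) (centre y) (side y).
Proof.
move=> e; split; first by apply: child_gap_eq; rewrite ?(qq'.1).
have [_ zu _] := at_face (digit_in uP) ru.
have [_ zv _] := at_face (digit_in vP) rv.
move=> k kd; apply/eqP; rewrite -subr_eq0 child_lateral //.
case: (ord3P d.1 k) kd => [->|->|->] // _; first by rewrite e subrr mul0r.
by rewrite zu zv !mulr0 subrr mul0r.
Qed.

End Children.

(** * Cubes with the same parent: a scaled picture of the gadget *)

Lemma local_size q u : (u < P)%N ->
  side (q * P + u)%N = side q / H%:~R * (digit u).2%:~R.
Proof. by move=> uP; rewrite child_size // mulrAC. Qed.

Lemma local_diff q u v k : (u < P)%N -> (v < P)%N ->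
  centre (q * P + v)%N k - centre (q * P + u)%N k =
  side q / H%:~R * ((digit v).1 k - (digit u).1 k)%:~R.
Proof.
move=> uP vP; rewrite !child_centre // rmorphB /=.
by field; rewrite gt_eqF ?H_gt0.
Qed.

Lemma local_gap d q u v : (u < P)%N -> (v < P)%N ->
  gap d (centre (q * P + u)%N) (centre (q * P + v)%N) =
  side q / H%:~R * (igap d (digit u) (digit v))%:~R.
Proof.
by move=> uP vP; rewrite /gap local_diff // /igap !rmorphM /=; ring.
Qed.

Lemma child_scale_gt0 q : 0 < side q / H%:~R.
Proof. by rewrite divr_gt0 ?side_gt0R ?H_gt0. Qed.

Lemma local_facing d q u v : (u < P)%N -> (v < P)%N ->
  facing d (centre (q * P + u)%N) (side (q * P + u)%N)
           (centre (q * P + v)%N) (side (q * P + v)%N)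
  <-> ifacing d (digit u) (digit v).
Proof.
move=> uP vP; have s0 := child_scale_gt0 q; have sn0 := lt0r_neq0 s0.
rewrite /facing local_gap // !local_size // -mulrDr -rmorphD /=.
split=> -[g l]; split.
- by move: g => /(mulfI sn0)/intr_inj.
- move=> k /l/eqP; rewrite -subr_eq0 local_diff // mulf_eq0 (negPf sn0) /=.
  by rewrite intr_eq0 subr_eq0 => /eqP.
- by rewrite g.
- move=> k /l e; apply/eqP; rewrite -subr_eq0 local_diff //.
  by rewrite e subrr mulr0.
Qed.

Lemma local_sep d q u v : (u < P)%N -> (v < P)%N ->
  iseparated r d (digit u) (digit v) -> sep d (q * P + u)%N (q * P + v)%N.
Proof.
move=> uP vP; have s0 := child_scale_gt0 q.
case=> [[f c]|g|[e [ed g1 g2]]].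
- apply: Or31; split; first exact/local_facing.
  rewrite /sim !local_size //.
  by case: c => [->|->|<-]; [apply: Or31|apply: Or32|apply: Or33];
    rewrite // rmorphM /= mulrCA.
- by apply: Or32; rewrite local_gap // !local_size // -mulrDr ltr_pM2l // -rmorphD ltr_int.
- apply: Or33; exists e; split=> //;
  by rewrite local_gap // !local_size // -mulrDr ler_pM2l // -rmorphD ler_int.
Qed.

Lemma ratio_gt1R : 1 < r%:~R :> F.
Proof. by rewrite ltr1z ratio_gt1. Qed.

(* Ports sit at multiples of [r]: two ports of facing cubes are therefore
   either aligned or far apart. *)
Lemma lateral_gap (s t : F) (a b : int) : 0 < s -> 0 < t -> sim s t ->
  (r %| a)%Z -> (r %| b)%Z -> s * a%:~R <> t * b%:~R ->
  s + t < 2 * `|t * b%:~R - s * a%:~R|.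
Proof.
have r1 := ratio_gt1R.
have key (c : F) (m : int) : 0 < c -> c * r%:~R * m%:~R <> 0 ->
    (1 + r%:~R) * c < 2 * `|c * r%:~R * m%:~R|.
  move=> c0 nz; have m1 : 1 <= `|m%:~R| :> F.
    rewrite -intr_norm ler1z -gtz0_ge1 normr_gt0.
    by apply/eqP => m0; apply: nz; rewrite m0 mulr0.
  have cr0 : 0 < c * r%:~R by rewrite mulr_gt0 // (lt_trans ltr01).
  rewrite normrM (gtr0_norm cr0); apply: lt_le_trans (_ : 2 * (c * r%:~R * 1) <= _).
    by rewrite -subr_gt0 (_ : _ - _ = c * (r%:~R - 1)) ?mulr_gt0 ?subr_gt0 //; ring.
  by rewrite ler_pM2l // ler_pM2l.
move=> s0 t0 c /dvdzP[i ->] /dvdzP[j ->] /eqP; rewrite -subr_eq0 -oppr_eq0 opprB => /eqP.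
case: c => [->|->|<-]; rewrite !rmorphM /= => nz.
- have E : t * (j%:~R * r%:~R) - t * (i%:~R * r%:~R) = t * r%:~R * (j - i)%:~R :> F.
    by rewrite rmorphB /=; ring.
  by rewrite E in nz *; apply: le_lt_trans (key _ _ t0 nz); nra.
- have E : t * (j%:~R * r%:~R) - r%:~R * t * (i%:~R * r%:~R) = t * r%:~R * (j - r * i)%:~R :> F.
    by rewrite rmorphB rmorphM /=; ring.
  by rewrite E in nz *; apply: le_lt_trans (key _ _ t0 nz); nra.
- have E : r%:~R * s * (j%:~R * r%:~R) - s * (i%:~R * r%:~R) = s * r%:~R * (r * j - i)%:~R :> F.
    by rewrite rmorphB rmorphM /=; ring.
  by rewrite E in nz *; apply: le_lt_trans (key _ _ s0 nz); nra.
Qed.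

Lemma sim_scale (c s t : F) : sim s t -> sim (s / c) (t / c).
Proof. by case=> [->|->|<-]; [apply: Or31|apply: Or32|apply: Or33]; rewrite // mulrA. Qed.

(** Facing parents are the delicate case. A child away from the common face leaves a positive gap;
    two children at this face are facing if they are aligned, and otherwise [lateral_gap] separates
    them sideways. *)
Lemma sep_child d q u q' v : (u < P)%N -> (v < P)%N -> sep d q q' ->
  exists e, sep e (q * P + u)%N (q' * P + v)%N.
Proof.
move=> uP vP; case=> [[f c]|g|[e [ed g1 g2]]]; last 2 first.
- by exists d; apply: Or32; apply: child_gap_lt.
- by exists d; apply: Or33; exists e; split=> //; apply: child_gap_le.
have [ru|/eqP ru] := eqVneq (reach d (digit u)) N; last first.
  by exists d; apply: Or32; apply: child_gap_away => //; [rewrite f.1|left].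
have [rv|/eqP rv] := eqVneq (reach (opp d) (digit v)) N; last first.
  by exists d; apply: Or32; apply: child_gap_away => //; [rewrite f.1|right].
have [su sv] := child_sides q q' uP vP ru rv.
have [e|/eqP e] := eqVneq (side q * ((digit u).1 (d.1 + 1))%:~R)
                          (side q' * ((digit v).1 (d.1 + 1))%:~R).
  exists d; apply: Or31; split; first exact: child_facing.
  by rewrite su sv; apply: sim_scale.
have [_ _ du] := at_face (digit_in uP) ru.
have [_ _ dv] := at_face (digit_in vP) rv.
have := lateral_gap (side_gt0R _) (side_gt0R _) c du dv e.
set D := _ - _ => lt; have [n1 _ _] := ord3_neq d.1.
(* Both children have coordinate 0 along [d.1 + 2] in their gadgets, so they differ sideways only
   along [d.1 + 1], in the direction given by the sign of [D]. *)
exists (d.1 + 1, D < 0); apply: Or32.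
rewrite /gap /= (child_lateral uP vP f n1) -/D su sv -mulrDl mulrA ltr_pM2r ?invr_gt0 ?H_gt0 //.
by apply: lt_le_trans lt _; rewrite /sgd /=; case: ltP => D0; [rewrite ltr0_norm|rewrite ger0_norm]; rewrite // ?mulrN1z ?mulr1z; lra.
Qed.

Lemma sep_exists x y : x <> y -> exists d, sep d x y.
Proof.
move=> xy; have lt z : (z <= maxn x y)%N -> (z < P ^ maxn x y)%N.
  by move=> /leq_ltn_trans; apply; apply: ltn_expl P_gt1.
move: (lt x (leq_maxl _ _)) (lt y (leq_maxr _ _)); move: (maxn x y) => n {lt}.
elim: n x y xy => [|n IH] x y xy.
  by rewrite !ltnS !leqn0 => /eqP x0 /eqP y0; case: xy; rewrite x0 y0.
move=> xn yn; have mP (z : nat) : (z %% P < P)%N by rewrite ltn_mod P_gt0.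
rewrite (divn_eq x P) (divn_eq y P).
have [E|/eqP nE] := eqVneq (x %/ P)%N (y %/ P)%N.
  rewrite -E; have [|d sd] := @cells_separated T _ _ (digit_in (mP x)) (digit_in (mP y)).
    by move=> /(digit_inj (mP x) (mP y)) e; apply: xy; rewrite (divn_eq x P) (divn_eq y P) E e.
  by exists d; apply: local_sep.
have [||d sd] := IH _ _ nE; try by rewrite ltn_divLR ?P_gt0 // -expnSr.
exact: sep_child sd.
Qed.

End Realization.

(** * Contacts and sphere packings *)

Section Contacts.
Variables (F : realFieldType) (T : layout).
Local Notation r := (ratio T).
Local Notation N := (box T).
Local Notation P := (size (cells T)).
Local Notation digit := (@digit T).
Local Notation side := (@side F T).
Local Notation centre := (@centre F T).
Local Notation sep := (@sep F T).

Definition lcontact (d : dir) (x y : nat) : Prop :=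
  facing d (centre x) (side x) (centre y) (side y).

Definition lface (d : dir) (u : nat) : Prop := reach d (digit u) = N.

(* [false] marks the larger cube of a pair of unequal cubes, which meets the
   smaller one only in the middle of its face. *)
Definition ltcontact (a b : bool) d x y : Prop :=
  lcontact d x y /\
  match a, b with
  | true, true => side x = side y
  | false, true => side x = r%:~R * side y
  | true, false => r%:~R * side x = side y
  | false, false => False
  end.

Lemma side_pos x : 0 < side x. Proof. exact: side_gt0R. Qed.

Lemma lcontact_sym d x y : lcontact d x y -> lcontact (opp d) y x.
Proof. exact: facing_sym. Qed.

Lemma lcontact_irr d x : ~ lcontact d x x.
Proof.
case=> g _; have := side_pos x; move: g.
by rewrite /gap subrr mulr0; lra.
Qed.

Lemma lcontact_neq d x y : lcontact d x y -> x <> y.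
Proof. by move=> c e; apply: (@lcontact_irr d x); rewrite {2}e. Qed.

Lemma sep_gap x y : x <> y -> exists e, side x + side y <= gap e (centre x) (centre y).
Proof.
move=> /(@sep_exists F T)[e []].
- by move=> [[g _] _]; exists e; rewrite g.
- by move=> g; exists e; rewrite ltW.
- by move=> [_ [_ g _]]; exists e.
Qed.

(** Two cubes facing [x] on the same side rest on one plane with centres on one line, so distinct
    ones would overlap. *)
Lemma lcontact_inj d x y z : lcontact d x y -> lcontact d x z -> y = z.
Proof.
move=> [gy ly] [gz lz]; apply/eqP/negP => /negP/eqP/sep_gap[e].
have := side_pos x; have := side_pos y; have := side_pos z => sx sy sz.
have [E|/eqP ne] := eqVneq e.1 d.1; last by rewrite /gap lz // ly // subrr mulr0; lra.
have [ed|ed] : e = d \/ e = opp d.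
  case: e d E {gy ly gz lz} => k b [k' b'] /= ->; rewrite /opp /=.
  by case: b b' => [] []; [left|right|right|left].
  have -> : gap e (centre y) (centre z) = gap d (centre x) (centre z) - gap d (centre x) (centre y).
    by rewrite ed /gap; ring.
  by rewrite gy gz; lra.
have -> : gap e (centre y) (centre z) = gap d (centre x) (centre y) - gap d (centre x) (centre z).
  by rewrite ed /gap sgd_opp mulrNz /=; ring.
by rewrite gy gz; lra.
Qed.

Lemma lcontactE d u v : (u < P)%N -> (v < P)%N ->
  lcontact d u v <-> ifacing d (digit u) (digit v).
Proof.
move=> uP vP; have := @local_facing F T d 0 u v uP vP.
by rewrite mul0n !add0n.
Qed.

Lemma lcontact_local d q u v : (u < P)%N -> (v < P)%N ->
  lcontact d (q * P + u)%N (q * P + v)%N <-> lcontact d u v.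
Proof. by move=> uP vP; rewrite (lcontactE d uP vP); apply: local_facing. Qed.

Lemma lcontact_sep d x y e : lcontact d x y -> sep e x y ->
  e = d /\ sim T (side x) (side y).
Proof.
move=> c; have sx := side_pos x; have sy := side_pos y.
have near e' : e' <> d -> gap e' (centre x) (centre y) < side x + side y.
  by apply: facing_gap.
have ed : side x + side y <= gap e (centre x) (centre y) -> e = d.
  move=> g; apply: contrapT => /near; lra.
case=> [[[g _] s]|g|[e' [e'e g g']]].
- by split=> //; apply: ed => //; rewrite g.
- have E : e = d by apply: ed => //; apply: ltW.
  by move: g; rewrite E c.1 ltxx.
have E : e = d by apply: ed.
have : e' <> d by move=> E'; apply: e'e; rewrite E' E.
by move=> /near; rewrite ltNge g'.
Qed.

(** Children inherit the separation of their parents, so the parents are separated in direction [d]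
    and in no other. They are not strictly separated either, hence facing; and a child away from the
    common face would leave a gap. *)
Lemma lcontact_cross d q q' u v : (u < P)%N -> (v < P)%N -> q <> q' ->
  lcontact d (q * P + u)%N (q' * P + v)%N ->
  [/\ lcontact d q q', lface d u & lface (opp d) v].
Proof.
move=> uP vP qq' c; have [e s] := @sep_exists F T _ _ qq'.
have near g := facing_gap (side_pos _) (side_pos _) c (e := g).
have [ee|ne] := pselect (e = d); last first.
  have := near _ ne; rewrite ltNge => /negP[]; apply: child_gap_le => //.
  case: s => [[[g _] _]|g|[e' [_ g _]]].
  - by rewrite g.
  - exact: ltW.
  - exact: g.
move: s; rewrite ee => -[[f _]|g|[e' [ne g g']]].
- split=> //; apply: contrapT => n.
    have := @child_gap_away F T d q u q' v uP vP (esym f.1) (or_introl n).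
    by rewrite c.1 ltxx.
  have := @child_gap_away F T d q u q' v uP vP (esym f.1) (or_intror n).
  by rewrite c.1 ltxx.
- by have := child_gap_lt uP vP g; rewrite c.1 ltxx.
have : e' <> d by move=> E; apply: ne; rewrite E.
by move=> /near; rewrite ltNge (child_gap_le uP vP g').
Qed.

Lemma lface_outer d u v : (u < P)%N -> (v < P)%N -> lface d u -> ~ lcontact d u v.
Proof.
move=> uP vP fu; rewrite (lcontactE d uP vP) => -[g _].
have := in_box d (digit_in vP); have := side_gt0 (digit_in vP).
move: fu g; rewrite /lface /reach /igap mulrBr => fu g sv ru.
have := ru; rewrite -fu; move: g sv; clear; lra.
Qed.

Lemma ltcontactW a b d x y : ltcontact a b d x y -> lcontact d x y.
Proof. by case. Qed.

Lemma lcontact_typed d x y : lcontact d x y -> exists a b, ltcontact a b d x y.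
Proof.
move=> c; have [e /(lcontact_sep c)[_ s]] := @sep_exists F T _ _ (lcontact_neq c).
by case: s => s; [exists true, true|exists false, true|exists true, false].
Qed.

(** The equation says that the lateral positions agree: coordinates in the larger parent are in
    units [r] times as long. The type persists because all boundary cells have side 1. *)
Lemma ltcontact_child (a b : bool) d q q' u v : (u < P)%N -> (v < P)%N ->
  lface d u -> lface (opp d) v -> ltcontact a b d q q' ->
  (if a then 1 else r) * (digit u).1 (d.1 + 1) =
  (if b then 1 else r) * (digit v).1 (d.1 + 1) ->
  ltcontact a b d (q * P + u)%N (q' * P + v)%N.
Proof.
move=> uP vP fu fv [c t] /(congr1 (fun z => z%:~R : F)); rewrite !rmorphM /= => e.
have [su sv] := child_sides F q q' uP vP fu fv.
split; last by rewrite su sv; case: a b t {e} => [] [] //; [move=> ->|move=> <-|move=> ->]; rewrite ?mulrA.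
apply: child_facing => //.
case: a b t e => [] [] //=; rewrite ?mul1r => t e.
- by rewrite t e.
- by rewrite -t e; ring.
- by rewrite t -e; ring.
Qed.

End Contacts.

Section Packing.
Variable R : realType.

(** * Tangency of balls in terms of squared distances *)

Section Balls.
Variable d : nat.
Implicit Types (a b z : 'rV[R]_d) (r s : R).

Definition dist2 a b : R := \sum_(i < d) (a ord0 i - b ord0 i) ^+ 2.

Lemma dist2_ge0 a b : 0 <= dist2 a b.
Proof. by apply: sumr_ge0 => i _; apply: sqr_ge0. Qed.

Lemma edist_lt a b r : 0 < r -> (Defs.edist a b < r) = (dist2 a b < r ^+ 2).
Proof.
move=> r0; rewrite /Defs.edist -/(dist2 a b) -{1}(gtr0_norm r0) -sqrtr_sqr.
by rewrite ltr_sqrt // exprn_gt0.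
Qed.

Lemma edist_eq a b r : 0 < r -> Defs.edist a b = r <-> dist2 a b = r ^+ 2.
Proof.
move=> r0; rewrite /Defs.edist -/(dist2 a b); split=> [<-|->].
  by rewrite sqr_sqrtr ?dist2_ge0.
by rewrite sqrtr_sqr gtr0_norm.
Qed.

(** Stewart's theorem with denominators cleared. The left side is nonnegative, and zero only at the
    point dividing the segment in the ratio [r : s]; this yields disjointness of the balls as well
    as uniqueness of the tangency point. *)
Lemma stewart a b z r s :
  \sum_(i < d) ((r + s) * z ord0 i - (s * a ord0 i + r * b ord0 i)) ^+ 2 =
  (r + s) * (s * dist2 a z + r * dist2 b z) - r * s * dist2 a b.
Proof.
rewrite /dist2 !mulr_sumr -big_split /= mulr_sumr -sumrB.
by apply: eq_bigr => i _; ring.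
Qed.

Lemma dist2_le a b z r s : 0 < r -> 0 < s ->
  r * s * dist2 a b <= (r + s) * (s * dist2 a z + r * dist2 b z).
Proof.
move=> r0 s0; rewrite -subr_ge0 -stewart.
by apply: sumr_ge0 => i _; apply: sqr_ge0.
Qed.

Lemma open_eballs_disjoint a b r s : 0 < r -> 0 < s ->
  (r + s) ^+ 2 <= dist2 a b -> open_eball a r `&` open_eball b s = set0.
Proof.
move=> r0 s0 far; apply/seteqP; split=> // z [] /=.
rewrite /open_eball /= !edist_lt // => za zb.
have rs : 0 < r * s by rewrite mulr_gt0.
have := dist2_le a b z r0 s0; rewrite leNgt => /negP; apply.
apply: lt_le_trans (_ : r * s * (r + s) ^+ 2 <= _); last by rewrite ler_pM2l.
rewrite (_ : r * s * _ = (r + s) * (s * r ^+ 2 + r * s ^+ 2)); last by ring.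
by rewrite ltr_pM2l ?addr_gt0 // ltrD // ltr_pM2l.
Qed.

Lemma tangentE a b r s : 0 < r -> 0 < s -> (r + s) ^+ 2 <= dist2 a b ->
  tangent a r b s <-> dist2 a b = (r + s) ^+ 2.
Proof.
move=> r0 s0 far; have rs : 0 < r * s by rewrite mulr_gt0.
have rs0 : r + s != 0 by rewrite gt_eqF // addr_gt0.
split=> [[z E]|E].
  have [/= /(edist_eq _ _ r0) za /(edist_eq _ _ s0) zb] :
    (esphere a r `&` esphere b s) z by rewrite E.
  apply/eqP; rewrite eq_le far andbT -(ler_pM2l rs).
  apply: le_trans (dist2_le a b z r0 s0) _; rewrite za zb.
  by rewrite (_ : r * s * _ = (r + s) * (s * r ^+ 2 + r * s ^+ 2)) //; ring.
pose c := \row_i ((s * a ord0 i + r * b ord0 i) / (r + s)).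
have dc (e : 'rV[R]_d) (t : R) : (forall i, e ord0 i - c ord0 i = t / (r + s) * (a ord0 i - b ord0 i)) ->
    dist2 e c = t ^+ 2.
  move=> h; rewrite /dist2 (eq_bigr (fun i => (t / (r + s)) ^+ 2 * (a ord0 i - b ord0 i) ^+ 2)).
    rewrite -mulr_sumr -/(dist2 a b) E -exprMn divfK //.
  by move=> i _; rewrite h exprMn.
exists c; apply/seteqP; split=> z /=; last first.
  move=> ->; split; apply/edist_eq => //.
    by apply: dc => i; rewrite mxE; field.
  by rewrite -(sqrrN s); apply: dc => i; rewrite mxE; field.
move=> [/(edist_eq _ _ r0) za /(edist_eq _ _ s0) zb].
have := stewart a b z r s; rewrite za zb E.
rewrite [RHS](_ : _ = 0); last by ring.
move=> /eqP; rewrite psumr_eq0 => [/allP h|i _]; last exact: sqr_ge0.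
apply/rowP => i; rewrite mxE; have := h i (mem_index_enum _).
by rewrite /= sqrf_eq0 subr_eq0 => /eqP <-; rewrite mulrC mulKf.
Qed.

End Balls.

Section Embedding.
Variables (T : layout) (m : nat).
Local Notation side := (@side R T).
Local Notation centre := (@centre R T).

Definition embed (p : 'I_3 -> R) : 'rV[R]_(3 + m) := row_mx (\row_k p k) 0.

Lemma dist2_embed (p q : 'I_3 -> R) :
  dist2 (embed p) (embed q) = \sum_(k < 3) (p k - q k) ^+ 2.
Proof.
rewrite /dist2 big_split_ord /= [X in _ + X]big1 ?addr0.
  by apply: eq_bigr => k _; rewrite /embed !row_mxEl !mxE.
by move=> k _; rewrite /embed !row_mxEr !mxE subrr expr0n.
Qed.

Lemma gap_sqr d (p q : 'I_3 -> R) : gap d p q ^+ 2 = 4 * (p d.1 - q d.1) ^+ 2.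
Proof.
by rewrite /gap /sgd; case: ifP => _; rewrite ?mulrN1z ?mulr1z; ring.
Qed.

(** The radii are half the sides, whence the factor 4. Cubes with a common edge have two coordinate
    gaps of at least [s + t], and the second square makes the inequality strict. *)
Lemma sep_dist2 d x y : sep R T d x y ->
  ((side x + side y) ^+ 2 < 4 * dist2 (embed (centre x)) (embed (centre y))) \/
  (lcontact R T d x y /\
   (side x + side y) ^+ 2 = 4 * dist2 (embed (centre x)) (embed (centre y))).
Proof.
have sx := side_pos R T x; have sy := side_pos R T y.
have s0 : 0 < side x + side y by rewrite addr_gt0.
rewrite dist2_embed (bigD1 d.1) //= mulrDr -gap_sqr.
have rest : 0 <= 4 * \sum_(i < 3 | i != d.1) (centre x i - centre y i) ^+ 2.
  by rewrite mulr_ge0 // sumr_ge0 // => i _; apply: sqr_ge0.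
case=> [[f _]|g|[e [ed g g']]].
- right; split=> //; rewrite f.1 big1 ?mulr0 ?addr0 // => i /eqP ne.
  by rewrite (f.2 i ne) subrr expr0n.
- by left; rewrite ltr_wpDr // ltr_pXn2r // nnegrE ltW // (lt_trans s0 g).
left; rewrite (bigD1 e.1) /=; last exact/eqP.
rewrite mulrDr -gap_sqr.
have le h : side x + side y <= gap h (centre x) (centre y) ->
    (side x + side y) ^+ 2 <= gap h (centre x) (centre y) ^+ 2.
  by move=> le; rewrite ler_pXn2r // nnegrE ltW // (lt_le_trans s0).
apply: le_lt_trans (le _ g) _; rewrite ltrDl ltr_wpDr //.
  by rewrite mulr_ge0 // sumr_ge0 // => i _; apply: sqr_ge0.
by apply: lt_le_trans (le _ g'); rewrite exprn_gt0.
Qed.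

Lemma dist2_ge x y : x <> y ->
  (side x / 2 + side y / 2) ^+ 2 <= dist2 (embed (centre x)) (embed (centre y)).
Proof.
move=> /(@sep_exists R T)[d /sep_dist2 h].
rewrite -(ler_pM2l (_ : 0 < 4)) // (_ : 4 * _ ^+ 2 = (side x + side y) ^+ 2); last by field.
by case: h => [/ltW|[_ ->]].
Qed.

Lemma dist2_eq x y : x <> y ->
  (exists d, lcontact R T d x y) <->
  dist2 (embed (centre x)) (embed (centre y)) = (side x / 2 + side y / 2) ^+ 2.
Proof.
move=> xy; have E : 4 * (side x / 2 + side y / 2) ^+ 2 = (side x + side y) ^+ 2 by field.
have [d sd] := @sep_exists R T _ _ xy.
split=> [[e c]|h].
  have [ed _] := lcontact_sep c sd.
  rewrite ed in sd; case: (sep_dist2 sd) => [lt|[_ h]].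
    case: c => g l; move: lt; rewrite dist2_embed (bigD1 e.1) //= mulrDr -gap_sqr.
    rewrite big1 ?mulr0 ?addr0 ?g ?ltxx // => i /eqP ne.
    by rewrite l // subrr expr0n.
  by apply: (@mulfI _ (4 : R)); rewrite ?E ?h // pnatr_eq0.
case: (sep_dist2 sd) => [|[c _]]; last by exists d.
by rewrite h E ltxx.
Qed.

End Embedding.

Lemma layout_sphere_packed (T : layout) (G : connected_graph) (phi : G -> nat) d :
  (3 <= d)%N -> injective phi ->
  (forall x y : G, adj x y <-> exists e, lcontact R T e (phi x) (phi y)) ->
  uniformly_sphere_packed R d G.
Proof.
move=> d3 phi_inj adjE; rewrite -(subnKC d3); set m := (d - 3)%N.
exists (ratio T)%:~R, (fun x => embed m (centre R T (phi x))), (fun x => side R T (phi x) / 2).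
have s0 x : 0 < side R T x / 2 by rewrite divr_gt0 ?side_pos.
have neq (x y : G) : x <> y -> phi x <> phi y by move=> xy /phi_inj.
have tE (x y : G) : x <> y -> adj x y <->
    tangent (embed m (centre R T (phi x))) (side R T (phi x) / 2)
            (embed m (centre R T (phi y))) (side R T (phi y) / 2).
  move=> /neq xy; apply: iff_trans (adjE x y) _.
  apply: iff_trans (@dist2_eq T m _ _ xy) _; apply: iff_sym.
  by apply: tangentE => //; apply: dist2_ge.
split.
  split=> // [x y xy|x y].
    by apply: open_eballs_disjoint => //; apply/dist2_ge/neq.
  split=> [xy|[xy /tE]]; last exact.
  have ne : x <> y by move=> E; rewrite E adj_irr in xy.
  by split=> //; apply/tE.
move=> x y xy /(tE _ _ xy)/adjE[e c].
have r1 := ratio_gt1R R T; have r0 : 0 < (ratio T)%:~R :> R by apply: lt_trans r1.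
have ri : (ratio T)%:~R^-1 <= 1 :> R by rewrite invf_le1 // ltW.
have [f sf] := @sep_exists R T _ _ (neq _ _ xy).
have [_ sim] := lcontact_sep c sf.
have h : side R T (phi x) / 2 / (side R T (phi y) / 2) = side R T (phi x) / side R T (phi y).
  by field; rewrite gt_eqF ?side_pos.
have sx := side_pos R T (phi x); have sy := side_pos R T (phi y).
rewrite h; case: sim => E.
- by rewrite E divff ?gt_eqF // ri ltW.
- by rewrite E mulfK ?gt_eqF // lexx andbT (le_trans ri) // ltW.
- by rewrite -E invfM mulrCA divff ?gt_eqF // mulr1 lexx (le_trans ri) // ltW.
Qed.

End Packing.

(** * The gadget *)

Section Gadget.
Variable w : nat.
Hypothesis w_gt0 : (0 < w)%N.

(* [r1] is the ratio of the sides of adjacent unequal cubes, and [half] the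
   largest coordinate of a unit cell; the cubes of an arm have sides
   [r3, r2, r1, 1, 1, 1] and centres [0, x2, x1, half - 2, half - 1, half]. *)
Definition r1 : int := 2 * w%:Z + 1.
Definition r2 : int := r1 * r1.
Definition r3 : int := r2 * r1.
Definition x1 : int := 4 * w%:Z ^+ 3 + 10 * w%:Z ^+ 2 + 8 * w%:Z + 2.
Definition x2 : int := 4 * w%:Z ^+ 3 + 8 * w%:Z ^+ 2 + 5 * w%:Z + 1.
Definition half : int := x1 + w%:Z + 3.

(** Adjacent arm cubes have centres half the sum of their sides apart; the polynomials in [w]
    express this without division by 2. The nonlinear arithmetic is done here, so that later
    arguments can be linear in these quantities. *)
Lemma constants : [/\ r1 = 2 * w%:Z + 1, r1 * 3 <= r2, r2 * 3 <= r3, x2 * 2 = r3 + r2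
  & x1 * 2 = x2 * 2 + r2 + r1 /\ half = x1 + w%:Z + 3].
Proof.
have w1 : 1 <= w%:Z by lia.
rewrite /half /x1 /x2 /r3 /r2 /r1; by split=> //; nia.
Qed.

(** The purpose of [r1 = 2 * w + 1]: the ports [r1 * i] stay below [r2 / 2] and the ports [r2 * i]
    below [r3 / 2], so the two scales never collide. *)
Lemma index_bounds (i : nat) : (0 < i <= w)%N ->
  [/\ r1 <= r1 * i%:Z, r1 * i%:Z * 2 <= r2 - r1, r2 <= r2 * i%:Z & r2 * i%:Z * 2 <= r3 - r2].
Proof.
move=> iw; have [i1 i2] : 1 <= i%:Z /\ i%:Z <= w%:Z by lia.
have [E h1 h2 _ _] := constants.
have r1_gt0 : 0 < r1 by lia.
have r2_gt0 : 0 < r2 by lia.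
split; try nia.
- have -> : r2 - r1 = r1 * (w%:Z * 2) by rewrite /r2 /r1; ring.
  by rewrite -mulrA ler_pM2l //; lia.
- have -> : r3 - r2 = r2 * (w%:Z * 2) by rewrite /r3 /r2 /r1; ring.
  by rewrite -mulrA ler_pM2l //; lia.
Qed.

Definition point (k : 'I_3) (x y z : int) : {ffun 'I_3 -> int} :=
  [ffun l => if l == k then x else if l == k + 1 then y else z].

Lemma pointE k x y z : [/\ point k x y z k = x, point k x y z (k + 1) = y
  & point k x y z (k + 2) = z].
Proof.
have [/eqP/negPf n1 /eqP/negPf n2 /eqP/negPf n3] := ord3_neq k.
by rewrite !ffunE eqxx n1 eqxx n2 eq_sym n3.
Qed.

Lemma point_eta k (v : {ffun 'I_3 -> int}) : point k (v k) (v (k + 1)) (v (k + 2)) = v.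
Proof.
by apply/ffunP => l; case: (ord3P k l) => ->; case: (pointE k (v k) (v (k + 1)) (v (k + 2))).
Qed.

Lemma ord3_add (k : 'I_3) : [/\ k + 1 + 1 = k + 2, k + 1 + 2 = k & k + 2 + 1 = k].
Proof. by case: k => [[|[|[|//]]] ?]; split; apply/val_inj. Qed.

Lemma point_rot k x y z : point (k + 1) y z x = point k x y z.
Proof.
have [p1 p2 p3] := pointE (k + 1) y z x; have [q1 q2 q3] := pointE k x y z.
have [e1 e2 _] := ord3_add k; rewrite e1 in p2; rewrite e2 in p3.
by apply/ffunP => l; case: (ord3P k l) => ->; rewrite ?q1 ?q2 ?q3.
Qed.

Definition ucell k x y z : cell := (point k x y z, 1).

Definition arm_pos (j : nat) : int :=
  match j with 0 => 0 | 1 => x2 | 2 => x1 | 3 => half - 2 | 4 => half - 1 | _ => half end.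

Definition arm_side (j : nat) : int :=
  match j with 0 => r3 | 1 => r2 | 2 => r1 | _ => 1 end.

Definition arm (d : dir) j : cell := (point d.1 (sgd d * arm_pos j) 0 0, arm_side j).

(* At depth 1 below each face a link connects the arm to all the nets. *)
Definition link_pos k (v : {ffun 'I_3 -> int}) :=
  [/\ `|v k| = half - 1, 0 <= v (k + 1) <= r2 * w%:Z & v (k + 2) = 0].

(* In the order of the cases: the ports of the net [i] on the faces orthogonal
   to the axis [k], columns at depth 1, a bus at depth 2 collecting the columns,
   and a run at depth 3 below the next face, which joins the two opposite buses
   and touches the bus of the axis [k + 1]. *)
Definition net_at (i : nat) (x y z : int) :=
  [\/ [/\ `|x| = half, y = r1 * i%:Z \/ y = r2 * i%:Z & z = 0],
      [/\ `|x| = half - 1, y = r1 * i%:Z \/ y = r2 * i%:Z & 0 <= z <= r1 * i%:Z],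
      [/\ `|x| = half - 2, 0 <= y <= half - 3 & z = r1 * i%:Z]
    | [/\ `|x| <= half - 2, y = half - 3 & z = r1 * i%:Z]].

Definition net_pos i k (v : {ffun 'I_3 -> int}) := net_at i (v k) (v (k + 1)) (v (k + 2)).

Definition net_cell i (u : cell) := [/\ (0 < i <= w)%N, u.2 = 1 & exists k, net_pos i k u.1].

Definition link_cell (u : cell) := u.2 = 1 /\ exists k, link_pos k u.1.

Definition is_cell (u : cell) :=
  [\/ exists d j, (j <= 5)%N /\ u = arm d j, link_cell u | exists i, net_cell i u].

(* A net runs along the surface of the box, but avoids the axes. *)
Lemma net_far i k v : (0 < i <= w)%N -> net_pos i k v ->
  exists l m, [/\ l <> m, half - 3 <= `|v l| & r1 <= `|v m|].
Proof.
move=> /index_bounds[b1 b2 b3 b4]; have [_ c1 c2 c3 [c4 c5]] := constants.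
have [n1 n2 n3] := ord3_neq k.
case=> [[e1 e2 e3]|[e1 e2 e3]|[e1 e2 e3]|[e1 e2 e3]].
- by exists k, (k + 1); split=> [||]; [exact/nesym|lia|case: e2 => ->; lia].
- by exists k, (k + 1); split=> [||]; [exact/nesym|lia|case: e2 => ->; lia].
- by exists k, (k + 2); split=> [||]; [exact/nesym|lia|lia].
- by exists (k + 1), (k + 2); split=> [||]; [|lia|lia].
Qed.

(** * Arms *)

Lemma sgd_sqr d : sgd d * sgd d = 1.
Proof. by rewrite /sgd; case: ifP. Qed.

Lemma sgd_norm d (x : int) : `|sgd d * x| = `|x|.
Proof. by rewrite normrM /sgd; case: ifP; rewrite ?normrN normr1 mul1r. Qed.

Lemma armE d j l : (arm d j).1 l = if l == d.1 then sgd d * arm_pos j else 0.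
Proof. by rewrite ffunE; case: eqP => // _; case: eqP. Qed.

Lemma arm0 d d' : arm d 0 = arm d' 0.
Proof.
by congr (_, _); apply/ffunP => l; rewrite -/((arm d 0).1 l) -/((arm d' 0).1 l) !armE !mulr0 !if_same.
Qed.

Lemma gap_of_norm l (u v : cell) :
  exists2 d, d.1 = l & igap d u v = 2 * `|v.1 l - u.1 l|.
Proof.
exists (l, v.1 l - u.1 l < 0) => //; rewrite /igap /sgd /=.
by case: ltP => h; [rewrite ltr0_norm|rewrite ger0_norm]; rewrite // ?mulr1 // mulrN1 mulrN mulNr.
Qed.

Definition strictly_separated (u v : cell) := exists d, u.2 + v.2 < igap d u v.

Lemma strict_of_norm l (u v : cell) : u.2 + v.2 < 2 * `|v.1 l - u.1 l| -> strictly_separated u v.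
Proof. by have [d _ <-] := gap_of_norm l u v; exists d. Qed.

Lemma igap_opp d (u v : cell) : igap (opp d) v u = igap d u v.
Proof. by rewrite /igap sgd_opp /=; ring. Qed.

Lemma strictly_separated_sym u v : strictly_separated u v -> strictly_separated v u.
Proof. by move=> [d lt]; exists (opp d); rewrite igap_opp addrC. Qed.

Lemma ifacing_sym d u v : ifacing d u v -> ifacing (opp d) v u.
Proof. by move=> [g l]; split=> [|k /l//]; rewrite igap_opp g addrC. Qed.

Lemma comparable_sym (a b : int) : comparable r1 a b -> comparable r1 b a.
Proof. by case=> [->|->|<-]; [apply: Or31|apply: Or33|apply: Or32]. Qed.

Lemma ifacing_not_strict d (u v : cell) : 0 < u.2 -> 0 < v.2 -> ifacing d u v ->
  ~ strictly_separated u v.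
Proof.
move=> su sv f [e lt].
have fR : facing d (fun k => (u.1 k)%:~R : rat) (u.2)%:~R (fun k => (v.1 k)%:~R) (v.2)%:~R.
  split=> [|k /f.2 -> //]; rewrite -rmorphD /= -f.1 /gap /igap !rmorphM rmorphB /=; ring.
have ltR : (u.2)%:~R + (v.2)%:~R <
    gap e (fun k => (u.1 k)%:~R : rat) (fun k => (v.1 k)%:~R).
  move: lt; rewrite -(ltr_int rat) rmorphD /= => lt; apply: lt_le_trans lt _.
  by rewrite /gap /igap !rmorphM rmorphB /= le_eqVlt; apply/orP; left; apply/eqP; ring.
have [E|ne] := pselect (e = d); first by move: ltR; rewrite E fR.1 ltxx.
rewrite -(ltr0z rat) in su; rewrite -(ltr0z rat) in sv.
by have := facing_gap su sv fR ne; rewrite ltNge (ltW ltR).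
Qed.

Lemma arm_step j j' : (j < j')%N -> (j' <= 5)%N ->
  arm_side j + arm_side j' <= 2 * (arm_pos j' - arm_pos j) /\
  (j' <> j.+1 -> arm_side j + arm_side j' < 2 * (arm_pos j' - arm_pos j)).
Proof.
have [c0 c1 c2 c3 [c4 c5]] := constants.
by move: j j' => [|[|[|[|[|[|j]]]]]] [|[|[|[|[|[|j']]]]]] //= _ _; split; lia.
Qed.

Lemma arm_succ j : (j < 5)%N ->
  arm_side j + arm_side j.+1 = 2 * (arm_pos j.+1 - arm_pos j) /\
  comparable r1 (arm_side j) (arm_side j.+1).
Proof.
have [c0 c1 c2 c3 [c4 c5]] := constants.
move: j => [|[|[|[|[|j]]]]] //= _; split; try lia; try (by apply: Or31);
  by apply: Or32; rewrite /r3 /r2; ring.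
Qed.

Lemma arm_far j : (0 < j)%N -> arm_side j <= r2 /\ r3 + r2 <= 2 * arm_pos j.
Proof.
have [c0 c1 c2 c3 [c4 c5]] := constants.
by move: j => [|[|[|[|[|[|j]]]]]] //= _; split; lia.
Qed.

Lemma arm_igap d j j' : igap d (arm d j) (arm d j') = 2 * (arm_pos j' - arm_pos j).
Proof.
rewrite /igap !armE eqxx.
rewrite (_ : _ * (_ - _) = 2 * (sgd d * sgd d) * (arm_pos j' - arm_pos j)); last by ring.
by rewrite sgd_sqr mulr1.
Qed.

Lemma arm_facing d j : (j < 5)%N -> ifacing d (arm d j) (arm d j.+1).
Proof.
move=> /arm_succ[e _]; split; first by rewrite arm_igap -e.
by move=> k /eqP/negPf kd; rewrite !armE kd.
Qed.

(** Besides separation this records which arm cubes touch, namely consecutive ones of one arm, the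
    hub belonging to all arms; [cell_depth_step] relies on it. *)
Lemma arm_arm d j d' j' : (j <= 5)%N -> (j' <= 5)%N -> arm d j <> arm d' j' ->
  (exists2 e, ifacing e (arm d j) (arm d' j') /\
      comparable r1 (arm_side j) (arm_side j')
    & (j' = j.+1 \/ j = j'.+1) /\ [\/ d = d', j = 0 | j' = 0])
  \/ strictly_separated (arm d j) (arm d' j').
Proof.
have [c0 c1 c2 c3 [c4 c5]] := constants.
have same e i i' : (i < i')%N -> (i' <= 5)%N ->
    (i' = i.+1 /\ ifacing e (arm e i) (arm e i') /\
      comparable r1 (arm_side i) (arm_side i'))
    \/ strictly_separated (arm e i) (arm e i').
  move=> ii i5; have [h1 h2] := arm_step ii i5.
  have [E|/eqP ne] := eqVneq i' i.+1; [left|right].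
    by rewrite E in i5 *; split=> //; split; [exact: arm_facing|exact: (arm_succ i5).2].
  by exists e; rewrite arm_igap h2.
have sameN e i i' : (i <= 5)%N -> (i' <= 5)%N -> i <> i' ->
    (exists2 f, ifacing f (arm e i) (arm e i') /\
        comparable r1 (arm_side i) (arm_side i') & i' = i.+1 \/ i = i'.+1)
    \/ strictly_separated (arm e i) (arm e i').
  move=> i5 i'5 ne; have [lt|gt|//] := ltngtP i i'.
    by have [[E f]|] := same e _ _ lt i'5; [left; exists e; [|left]|right].
  have [[E [f c]]|st] := same e _ _ gt i5; [left|right].
    by exists (opp e); [split; [exact: ifacing_sym|exact: comparable_sym]|right].
  exact: strictly_separated_sym.
move=> j5 j'5 ne.
have [dd|/eqP dd] := eqVneq d d'.
  have jj : j <> j' by move=> E; apply: ne; rewrite dd E.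
  rewrite -dd; have [[f h1 h2]|] := sameN d j j' j5 j'5 jj; last by right.
  by left; exists f => //; split=> //; apply: Or31.
have [j0|j0] := posnP j.
  have jj : j <> j' by move=> E; apply: ne; rewrite -E j0 (arm0 d d').
  have -> : arm d j = arm d' j by rewrite j0 (arm0 d d').
  have [[f h1 h2]|] := sameN d' j j' j5 j'5 jj; last by right.
  by left; exists f => //; split=> //; apply: Or32.
have [j'0|j'0] := posnP j'.
  have jj : j <> j' by move=> E; move: j0; rewrite E j'0.
  have -> : arm d' j' = arm d j' by rewrite j'0 (arm0 d d').
  have [[f h1 h2]|] := sameN d j j' j5 j'5 jj; last by right.
  by left; exists f => //; split=> //; apply: Or33.
right; have [h1 h2] := arm_far j0; have [h1' h2'] := arm_far j'0.
have [dd1|/eqP dd1] := eqVneq d'.1 d.1.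
  have dO : d' = opp d.
    case: d d' dd dd1 {ne} => k b [k' b'] /= + E; rewrite E /opp /=.
    by case: b b' => [] [] // ne; case: ne.
  exists d'; rewrite dO /igap !armE eqxx sgd_opp.
  rewrite (_ : _ * (_ - _) = 2 * (sgd d * sgd d) * (arm_pos j + arm_pos j')); last by ring.
  by rewrite sgd_sqr /=; lia.
apply: (@strict_of_norm d.1); rewrite !armE eqxx eq_sym.
by move/eqP/negPf: dd1 => ->; rewrite sub0r normrN sgd_norm /=; lia.
Qed.

(** Two ways to avoid the large cubes of the arms: nets keep away from the axes, and links lie in a
    layer beyond the outer face of the cube of side [r1], which is at [half - 5/2]. *)
Definition off_axis (v : {ffun 'I_3 -> int}) :=
  (exists l m, [/\ l <> m, half - 3 <= `|v l| & r1 <= `|v m|])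
  \/ exists l, half - 1 <= `|v l|.

Lemma off_axis_arm (u : cell) d j : u.2 = 1 -> off_axis u.1 -> (j <= 2)%N ->
  strictly_separated u (arm d j).
Proof.
have [c0 c1 c2 c3 [c4 c5]] := constants.
have key l : half - 3 <= `|u.1 l| -> l <> d.1 -> u.2 = 1 -> (j <= 2)%N ->
    strictly_separated u (arm d j).
  move=> ul ld u1 j2; apply: (@strict_of_norm l); rewrite armE.
  move/eqP/negPf: ld => ->; rewrite sub0r normrN u1 /=.
  by move: j j2 => [|[|[|j]]] //= _; lia.
move=> u1 [[l [m [lm ul um]]]|[l ul]] j2; have [ld|/eqP/key] := eqVneq l d.1.
- have md : (m == d.1) = false by apply/eqP; rewrite -ld; apply/nesym.
  have [->|jn] := eqVneq j 2%N.
    by apply: (@strict_of_norm m); rewrite armE md sub0r normrN u1 /=; lia.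
  apply: (@strict_of_norm l); rewrite armE -ld eqxx u1 /= /sgd.
  by move: j jn j2 {key} => [|[|[|j]]] //= _ _; case: ifP => _; lia.
- exact.
- apply: (@strict_of_norm l); rewrite armE -ld eqxx u1 /= /sgd.
  by move: j j2 {key} => [|[|[|j]]] //= _; case: ifP => _; lia.
- by apply=> //; lia.
Qed.

(** For integral centres there are three cases: a coordinate differs by at least 2, two coordinates
    differ by 1 and at most an edge is shared, or a single one differs by 1 and the cubes are
    facing. *)
Lemma unit_sep (u v : cell) : u.2 = 1 -> v.2 = 1 -> u <> v -> exists d, iseparated r1 d u v.
Proof.
move=> u1 v1 uv.
have [[l ge2]|lt2] := pselect (exists l, 2 <= `|v.1 l - u.1 l|).
  have [|d lt] := @strict_of_norm l u v; first by rewrite u1 v1; lia.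
  by exists d; apply: Or32.
have le1 l : `|v.1 l - u.1 l| <= 1.
  by rewrite leNgt; apply/negP => gt; apply: lt2; exists l; lia.
have [k uk] : exists k, v.1 k <> u.1 k.
  apply: contrapT => h; apply: uv; apply/esym; case: u v u1 v1 h {lt2 le1} => [u a] [v b] /= -> -> h.
  by congr (_, _); apply/ffunP => k; apply: contrapT => ne; apply: h; exists k.
have norm1 l : v.1 l <> u.1 l -> `|v.1 l - u.1 l| = 1 by have := le1 l; lia.
have [d dk gd] := gap_of_norm k u v.
exists d; have [[l lk ul]|same] := pselect (exists2 l, l <> k & v.1 l <> u.1 l).
  have [e el ge] := gap_of_norm l u v.
  by apply: Or33; exists e; rewrite el dk gd ge u1 v1 !norm1.
apply: Or31; rewrite u1 v1; split; last exact: Or31.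
split; first by rewrite gd u1 v1 norm1.
by move=> l; rewrite dk => lk; apply: contrapT => ul; apply: same; exists l.
Qed.

Lemma link_unit u k : link_pos k u -> `|u k| <= half - 1 /\
  forall l, l <> k -> 0 <= u l /\ u l <= half - 3.
Proof.
have [c0 c1 c2 c3 [c4 c5]] := constants.
have [|_ _ _ b] := @index_bounds w; first by rewrite w_gt0 /=.
move=> [e1 e2 e3]; split; first by lia.
by move=> l; case: (ord3P k l) => -> // _; lia.
Qed.

Lemma net_unit i u k : (0 < i <= w)%N -> net_pos i k u -> `|u k| <= half /\
  forall l, l <> k -> 0 <= u l /\ u l <= half - 3.
Proof.
move=> /index_bounds[b1 b2 b3 b4]; have [c0 c1 c2 c3 [c4 c5]] := constants.
case=> [[e1 e2 e3]|[e1 e2 e3]|[e1 e2 e3]|[e1 e2 e3]]; (split; first by lia);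
  by move=> l; case: (ord3P k l) => -> // _; lia.
Qed.

Lemma unit_reach d (u : cell) : u.2 = 1 -> reach d u <= 2 * `|u.1 d.1| + 1.
Proof.
by move=> u1; rewrite /reach u1 -(sgd_norm d) -mulrA lerD2r ler_pM2l // ler_norm.
Qed.

Lemma arm_reach d e j : (j <= 5)%N ->
  reach e (arm d j) <= 2 * half + 1 /\
  (reach e (arm d j) = 2 * half + 1 -> e = d /\ j = 5%N).
Proof.
have [c0 c1 c2 c3 [c4 c5]] := constants.
have bound i : (i <= 5)%N -> 0 <= arm_pos i /\ 2 * arm_pos i + arm_side i <= 2 * half + 1 /\
    (2 * arm_pos i + arm_side i = 2 * half + 1 -> i = 5%N) /\ arm_side i < 2 * half + 1.
  by move: i => [|[|[|[|[|[|i]]]]]] //= _; do !split; lia.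
move=> /bound[h1 [h2 [h3 h4]]]; rewrite /reach armE -[(arm d j).2]/(arm_side j).
have [E|ne] := eqVneq e.1 d.1; last first.
  by rewrite mulr0 add0r; split; [lia|move=> h; exfalso; lia].
have [->|ed] := eqVneq e d.
  rewrite mulrA -(mulrA 2) sgd_sqr mulr1; split=> // h; split=> //; exact: h3.
have -> : e = opp d.
  case: e d E ed {h1 h2 h3 h4} => k b [k' b'] /= ->; rewrite /opp /=.
  by case: b b' => [] [] //; rewrite eqxx.
rewrite sgd_opp (_ : _ * (_ * _) = - (2 * (sgd d * sgd d) * arm_pos j)); last by ring.
by rewrite sgd_sqr mulr1; split; [lia|move=> h; exfalso; lia].
Qed.

Lemma cell_reach u d : is_cell u -> reach d u <= 2 * half + 1.
Proof.
case=> [[e [j [j5 ->]]]|[u1 [k /link_unit[h1 h2]]]|[i [iw u1 [k /(net_unit iw)[h1 h2]]]]].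
- by have [] := arm_reach e d j5.
- apply: le_trans (unit_reach d u1) _.
  by have [->|/eqP/h2] := eqVneq d.1 k; lia.
- apply: le_trans (unit_reach d u1) _.
  by have [->|/eqP/h2] := eqVneq d.1 k; lia.
Qed.

Lemma cell_at_face u d : is_cell u -> reach d u = 2 * half + 1 ->
  u = arm d 5 \/ exists i, [/\ (0 < i <= w)%N, u.2 = 1, `|u.1 d.1| = half,
    u.1 (d.1 + 1) = r1 * i%:Z \/ u.1 (d.1 + 1) = r2 * i%:Z & u.1 (d.1 + 2) = 0].
Proof.
case=> [[e [j [j5 ->]]] h|[u1 [k lk]] h|[i [iw u1 [k nk]]] h].
- by have [_ /(_ h)[-> ->]] := arm_reach e d j5; left.
- have [h1 h2] := link_unit lk; have := unit_reach d u1; rewrite h.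
  by have [->|/eqP/h2] := eqVneq d.1 k; lia.
right; have [h1 h2] := net_unit iw nk; have := unit_reach d u1; rewrite h.
have [dk|/eqP/h2] := eqVneq d.1 k; last by lia.
move=> le; rewrite dk in le *; exists i; have uk : `|u.1 k| = half by lia.
by case: nk => -[e1 e2 e3]; split=> //; lia.
Qed.

Lemma cell_sep u v : is_cell u -> is_cell v -> u <> v ->
  exists d, iseparated r1 d u v.
Proof.
have kind x : is_cell x -> (exists d j, (j <= 5)%N /\ x = arm d j) \/
    (x.2 = 1 /\ off_axis x.1).
  case=> [[d [j h]]|[x1 [k [e _ _]]]|[i [iw x1 [k nk]]]]; first by left; exists d, j.
    by right; split=> //; right; exists k; rewrite e.
  by right; split=> //; left; apply: net_far nk.
have of_strict x y : strictly_separated x y -> exists d, iseparated r1 d x y.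
  by move=> [d lt]; exists d; apply: Or32.
have arm_unit x d j : (j <= 5)%N -> x.2 = 1 -> off_axis x.1 ->
    strictly_separated x (arm d j) \/ (arm d j).2 = 1.
  move=> j5 x1 ox; have [j2|j2] := leqP j 2; first by left; apply: off_axis_arm.
  by right; move: j j2 {j5} => [|[|[|j]]].
move=> /kind[[d [j [j5 ->]]]|[u1 ou]] /kind[[d' [j' [j'5 ->]]]|[v1 ov]] ne.
- have [[e [f c] _]|] := arm_arm j5 j'5 ne; last exact: of_strict.
  by exists e; apply: Or31.
- have [|a1] := arm_unit v d j j5 v1 ov; last exact: unit_sep.
  by move/strictly_separated_sym/of_strict.
- by have [/of_strict|a1] := arm_unit u d' j' j'5 u1 ou; last exact: unit_sep.
- exact: unit_sep.
Qed.

(** * Enumeration of the cells *)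

Definition box_side : nat := `|(2 * half + 1)%R|%N.

Definition box_points : seq {ffun 'I_3 -> int} :=
  [seq [ffun k => (nat_of_ord (f k))%:Z - half] | f : {ffun 'I_3 -> 'I_box_side}].

Definition other_cells : seq cell :=
  [seq u <- undup [seq (v, t) | v <- box_points, t <- [:: 1; r1; r2]]
  | (u != hub r3) && `[< is_cell u >]].

Lemma box_pointsP (v : {ffun 'I_3 -> int}) :
  (forall k, `|v k| <= half) -> v \in box_points.
Proof.
move=> vh; have lt k : (`|(v k + half)%R| < box_side)%N.
  by rewrite /box_side; have := vh k; lia.
apply/mapP; exists [ffun k => Ordinal (lt k)]; first by rewrite mem_enum.
by apply/ffunP => k; rewrite !ffunE /=; have := vh k; lia.
Qed.

Lemma hub_arm d : hub r3 = arm d 0.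
Proof. by congr (_, _); apply/ffunP => l; rewrite !ffunE mulr0 !if_same. Qed.

Lemma is_cell_hub : is_cell (hub r3).
Proof. by apply: Or31; exists (ord0, true), 0%N; rewrite (hub_arm (ord0, true)). Qed.

Lemma mem_cells u : u \in hub r3 :: other_cells <-> is_cell u.
Proof.
rewrite inE mem_filter mem_undup; split=> [/orP[/eqP->|/andP[/andP[_ /asboolP]//]]|uc].
  exact: is_cell_hub.
have [//|ne] := eqVneq u (hub r3); rewrite orFb; apply/andP; split.
  by rewrite /= asboolT.
rewrite [u]surjective_pairing; apply: allpairs_f.
  apply: box_pointsP => k.
  have := cell_reach (k, true) uc; have := cell_reach (k, false) uc.
  rewrite /reach /sgd /= => h1 h2.
  have u0 : 0 < u.2.
    case: uc => [[d [j [j5 ->]]]|[->]//|[i [_ ->]]//].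
    have [c0 c1 c2 c3 [c4 c5]] := constants.
    by move: j j5 => [|[|[|j]]] //= _; lia.
  move: (u.1 k) u.2 h1 h2 u0 => x t; lia.
rewrite !inE; case: uc => [[d [j [_ E]]]|[->]|[i [_ ->]]]; rewrite ?eqxx //.
move: ne; rewrite (hub_arm d) E.
by case: j {E} => [|[|[|j]]]; rewrite ?eqxx ?orbT.
Qed.

Lemma size_other_cells : (size other_cells <= 3 * box_side ^ 3)%N.
Proof.
apply: leq_trans (size_subseq (filter_subseq _ _)) _.
apply: leq_trans (size_undup _) _; rewrite size_allpairs mulnC leq_mul2l /=.
by rewrite size_map -cardE card_ffun !card_ord.
Qed.

Lemma r1_gt1 : 1 < r1.
Proof. by have [c0 _ _ _ _] := constants; lia. Qed.

Lemma cells_uniq_gadget : uniq (hub r3 :: other_cells).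
Proof. by rewrite /= mem_filter eqxx /= filter_uniq // undup_uniq. Qed.

Lemma other_cells_gt0 : (0 < size other_cells)%N.
Proof.
have: arm (ord0, true) 5 \in hub r3 :: other_cells.
  by apply/mem_cells/Or31; exists (ord0, true), 5%N.
rewrite inE => /orP[/eqP/(congr1 (fun u : cell => u.2))|].
  by have [c0 c1 c2 _ _] := constants; rewrite /=; lia.
by case: other_cells.
Qed.

Lemma gadget_side_gt0 u : u \in hub r3 :: other_cells -> 0 < u.2.
Proof.
move=> /mem_cells[[d [j [j5 ->]]]|[->]//|[i [_ ->]]//].
have [c0 c1 c2 c3 [c4 c5]] := constants.
by move: j j5 => [|[|[|j]]] //= _; lia.
Qed.

Lemma gadget_at_face u d : u \in hub r3 :: other_cells -> reach d u = 2 * half + 1 ->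
  [/\ u.2 = 1, u.1 (d.1 + 2) = 0 & (r1 %| u.1 (d.1 + 1)%R)%Z].
Proof.
have [n1 n2 n3] := ord3_neq d.1.
move=> /mem_cells uc /(cell_at_face uc)[->|[i [iw u1 _ e2 e3]]].
  by rewrite !armE; move/eqP/negPf: n1 => ->; move/eqP/negPf: n2 => ->; rewrite dvdz0.
split=> //; case: e2 => ->; first exact: dvdz_mulr.
by rewrite /r2 -mulrA dvdz_mulr.
Qed.

Definition gadget : layout.
Proof.
apply: (@Layout r1 (2 * half + 1) r3 other_cells).
- exact: r1_gt1.
- exact: cells_uniq_gadget.
- exact: other_cells_gt0.
- exact: gadget_side_gt0.
- by move=> u d /mem_cells; apply: cell_reach.
- exact: gadget_at_face.
- by move=> u v /mem_cells uc /mem_cells vc; apply: cell_sep.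
Defined.

(** * The depth below a face *)

Lemma arm_pos_ge0 j : 0 <= arm_pos j.
Proof.
have [c0 c1 c2 c3 [c4 c5]] := constants.
by move: j => [|[|[|[|[|[|j]]]]]] //=; lia.
Qed.

Lemma arm_side_gt0 j : 0 < arm_side j.
Proof.
have [c0 c1 c2 c3 [c4 c5]] := constants.
by move: j => [|[|[|[|[|[|j]]]]]] //=; lia.
Qed.

Lemma arm_pos_inj j j' : (j <= 5)%N -> (j' <= 5)%N -> arm_pos j = arm_pos j' -> j = j'.
Proof.
move=> j5 j'5 e; have [lt|gt|//] := ltngtP j j'.
- have [+ _] := arm_step lt j'5; have := arm_side_gt0 j; have := arm_side_gt0 j'.
  by rewrite e subrr; lia.
- have [+ _] := arm_step gt j5; have := arm_side_gt0 j; have := arm_side_gt0 j'.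
  by rewrite e subrr; lia.
Qed.

Lemma arm_inj d j d' j' : (j <= 5)%N -> (j' <= 5)%N -> arm d j = arm d' j' ->
  j = j' /\ (j = 0%N \/ d = d').
Proof.
move=> j5 j'5 E; have E' k : (arm d j).1 k = (arm d' j').1 k by rewrite E.
have z0 i : (i <= 5)%N -> arm_pos i = 0 -> i = 0%N by move=> i5; apply: (@arm_pos_inj i 0).
have s0 e x : sgd e * x = 0 -> x = 0.
  by move=> h; apply/eqP; rewrite -normr_eq0 -(sgd_norm e) h normr0.
have [dd|/eqP dd] := eqVneq d.1 d'.1; last first.
  have := E' d.1; have := E' d'.1; rewrite !armE !eqxx (eq_sym d'.1).
  move/eqP/negPf: dd => -> /esym/s0/(z0 _ j'5) -> /s0/(z0 _ j5) ->.
  by split=> //; left.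
have := E' d.1; rewrite !armE dd !eqxx => e.
have jj : j = j'.
  apply: arm_pos_inj => //; have := congr1 Num.norm e.
  by rewrite !sgd_norm !ger0_norm ?arm_pos_ge0.
split=> //; have [->|jn] := eqVneq j 0%N; [by left|right].
have T0 : arm_pos j != 0 by apply/eqP => /(z0 _ j5)/eqP; rewrite (negPf jn).
move: e; rewrite -jj => /(mulIf T0).
by case: d d' dd {E E'} => k [] [k' []] /= -> //; rewrite /sgd.
Qed.

Definition arm_index (u : cell) : option (dir * nat) :=
  if pselect (exists p : dir * nat, (p.2 <= 5)%N /\ u = arm p.1 p.2) is left h
  then Some (projT1 (cid h)) else None.

(** Along the arms this counts steps from the end of the arm [d]; elsewhere it is the coordinate
    distance from the face, capped at 10. On an arm of another direction the cube [j] has depth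
    [5 + j], while cells beside it have depth 10, so the links may branch off no deeper than at
    [j = 4]. *)
Definition cell_depth (d : dir) (u : cell) : nat :=
  if arm_index u is Some (e, j) then if e == d then (5 - j)%N else (5 + j)%N
  else minn 10 `|(half - sgd d * u.1 d.1)%R|%N.

Lemma depth_arm d e j : (j <= 5)%N ->
  cell_depth d (arm e j) = if e == d then (5 - j)%N else (5 + j)%N.
Proof.
move=> j5; rewrite /cell_depth /arm_index; case: pselect => [h|[]]; last by exists (e, j).
case: cid => -[e' j'] /= [j'5 /(arm_inj j5 j'5)[<- [->|<- //]]].
by rewrite !if_same.
Qed.

Definition is_arm (u : cell) := exists d j, (j <= 5)%N /\ u = arm d j.

Lemma depth_off d u : ~ is_arm u ->
  cell_depth d u = minn 10 `|(half - sgd d * u.1 d.1)%R|%N.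
Proof.
move=> nu; rewrite /cell_depth /arm_index; case: pselect => // -[[e j] /= h].
by case: nu; exists e, j.
Qed.

Lemma off_arm_unit u : is_cell u -> ~ is_arm u -> u.2 = 1 /\ off_axis u.1.
Proof.
case=> [//|[u1 [k [e _ _]]]|[i [iw u1 [k nk]]]] _; split=> //.
- by right; exists k; rewrite e.
- by left; apply: net_far nk.
Qed.

Lemma ifacing_irr d u : 0 < u.2 -> ~ ifacing d u u.
Proof.
move=> u0 [g _]; move: u0 g; rewrite /igap subrr mulr0.
by move: u.2 => t; lia.
Qed.

Lemma unit_facing d (u v : cell) : u.2 = 1 -> v.2 = 1 -> ifacing d u v ->
  v.1 d.1 = u.1 d.1 + sgd d.
Proof.
move=> u1 v1 [+ _]; rewrite /igap u1 v1 -mulrA => h2.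
have h : sgd d * (v.1 d.1 - u.1 d.1) = 1 by move: (sgd d * _) h2 => t; lia.
apply/eqP; rewrite addrC -subr_eq; apply/eqP.
by rewrite -[LHS]mul1r -(sgd_sqr d) -mulrA h mulr1.
Qed.

(** Such a contact occurs only between the cube 4 of an arm and the beginning of a link. The depths
    there are both 1 below the face of this arm, and 9 and 10 for the other faces. *)
Lemma arm_off_facing d f u v : is_arm u -> is_cell v -> ~ is_arm v -> ifacing f u v ->
  (cell_depth d v <= (cell_depth d u).+1)%N /\ (cell_depth d u <= (cell_depth d v).+1)%N.
Proof.
have [c0 c1 c2 c3 [c4 c5]] := constants.
move=> [e [j [j5 ->]]] vc nv fc; have [v1 ov] := off_arm_unit vc nv.
have j3 : (2 < j)%N.
  rewrite ltnNge; apply/negP => j2.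
  have := off_axis_arm e v1 ov j2; apply: ifacing_not_strict (ifacing_sym fc).
    by rewrite v1.
  exact: arm_side_gt0.
have a1 : (arm e j).2 = 1 by move: j j3 {j5 fc} => [|[|[|j]]].
have f1 := unit_facing a1 v1 fc.
have near l : `|v.1 l - (arm e j).1 l| <= 1.
  have [->|/eqP lf] := eqVneq l f.1; last by rewrite fc.2 // subrr.
  by rewrite f1 addrAC subrr add0r /sgd; case: ifP.
have zero l : l <> e.1 -> `|v.1 l| <= 1.
  by move=> /eqP/negPf le; have := near l; rewrite armE le subr0.
case: vc => [//|[_ [k [k1 k2 k3]]]|[i [iw _ [k nk]]]]; last first.
  have [l [m [lm hl hm]]] := net_far iw nk; exfalso.
  have [le|/eqP/zero] := eqVneq l e.1; last by lia.
  have /zero : m <> e.1 by rewrite -le; apply/nesym.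
  by lia.
have ke : k = e.1 by apply: contrapT => /zero; lia.
have [n1 n2 n3] := ord3_neq k.
have yn : v.1 (k + 1) <> 0.
  move=> y0; apply: nv; exists (k, v.1 k < 0), 4%N; split=> //.
  case: v k1 k2 k3 y0 v1 {ov fc f1 near zero} => v t /= k1 k2 k3 y0 ->.
  congr (_, _); rewrite -{1}(point_eta k v) y0 k3; congr point.
  by rewrite /sgd /=; case: ltP k1 => h; [rewrite ltr0_norm|rewrite ger0_norm] => // <-; ring.
have fk : f.1 = k + 1.
  apply: contrapT => fk; apply: yn; rewrite fc.2; last exact/nesym.
  by rewrite armE -ke; move/eqP/negPf: n1 => ->.
have vk : v.1 k = sgd e * arm_pos j.
  by rewrite fc.2 ?armE ?ke ?eqxx // -ke fk; apply/nesym.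
have j4 : j = 4%N.
  apply: arm_pos_inj => //; rewrite -[LHS]ger0_norm ?arm_pos_ge0 //.
  by rewrite -(sgd_norm e) -vk k1.
have y1 : `|v.1 (k + 1)| <= 1 by apply: zero; rewrite -ke.
rewrite depth_arm // depth_off // j4.
have far x : half - 1 <= x -> minn 10 `|x|%N = 10%N by lia.
have [ed|ed] := eqVneq e d.
  by rewrite -ed -ke vk mulrA sgd_sqr mul1r j4 /=; lia.
have [dk|/eqP dk] := eqVneq d.1 e.1; last first.
  rewrite far //; have := zero _ dk; rewrite -(sgd_norm d).
  by move: (sgd d * _) => x; lia.
have -> : d = opp e.
  case: e d dk ed {fc a1 f1 near zero ke vk far} => l b [l' b'] /= ->; rewrite /opp /=.
  by case: b b' => [] [] //; rewrite eqxx.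
rewrite far // sgd_opp /= -ke vk j4 /= mulNr mulrA sgd_sqr mul1r; lia.
Qed.

Lemma cell_depth_step d f u v : is_cell u -> is_cell v -> ifacing f u v ->
  (cell_depth d v <= (cell_depth d u).+1)%N.
Proof.
move=> uc vc fc.
have [ua|nu] := pselect (is_arm u); have [va|nv] := pselect (is_arm v).
- case: ua va fc => [e [j [j5 ->]]] [e' [j' [j'5 ->]]] fc.
  have ne : arm e j <> arm e' j'.
    by move=> E; apply: (@ifacing_irr f (arm e j) (arm_side_gt0 j)); rewrite {2}E.
  have [[_ _ [jj ee]]|st] := arm_arm j5 j'5 ne; last first.
    by case: (@ifacing_not_strict f (arm e j) (arm e' j') (arm_side_gt0 j) (arm_side_gt0 j') fc st).
  rewrite !depth_arm //; case: ee => [<-|j0|j0].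
  + by case: ifP; lia.
  + by rewrite j0; case: ifP; case: ifP; lia.
  + by rewrite j0; case: ifP; case: ifP; lia.
- by have [] := arm_off_facing d ua vc nv fc.
- by have [] := arm_off_facing d va uc nu (ifacing_sym fc).
have [u1 _] := off_arm_unit uc nu; have [v1 _] := off_arm_unit vc nv.
have f1 := unit_facing u1 v1 fc.
rewrite !depth_off //; have [E|/eqP ne] := eqVneq d.1 f.1; last by rewrite fc.2 //; lia.
rewrite E f1; have : `|sgd d * sgd f| <= 1 by rewrite sgd_norm /sgd; case: ifP.
rewrite mulrDr; move: (sgd d * u.1 _) (_ * _) => x y; lia.
Qed.

(** * Connectedness of the gadget and of each net *)

Definition cadj (u v : cell) : bool := `[< exists d, ifacing d u v >].

Lemma cadj_sym : symmetric cadj.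
Proof.
by move=> u v; apply/asboolP/asboolP => -[d /ifacing_sym]; exists (opp d).
Qed.

Definition joined (A : cell -> Prop) u v :=
  exists s, [/\ path cadj u s, last u s = v & forall x, x \in u :: s -> A x].

Lemma joined_refl (A : cell -> Prop) u : A u -> joined A u u.
Proof. by move=> Au; exists [::]; split=> // x; rewrite inE => /eqP->. Qed.

Lemma joined_step (A : cell -> Prop) d u v : A u -> A v -> ifacing d u v -> joined A u v.
Proof.
move=> Au Av f; exists [:: v]; split=> //=; first by rewrite andbT; apply/asboolP; exists d.
by move=> x; rewrite !inE => /orP[] /eqP->.
Qed.

Lemma joined_trans A u v x : joined A u v -> joined A v x -> joined A u x.
Proof.
move=> [s [us <- As]] [t [vt <- At]]; exists (s ++ t).
rewrite cat_path us vt last_cat; split=> // y; rewrite -cat_cons mem_cat.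
by move=> /orP[/As//|yt]; apply: At; rewrite inE yt orbT.
Qed.

Lemma joined_sym A u v : joined A u v -> joined A v u.
Proof.
move=> [s [us <- As]]; exists (rev (belast u s)); split.
- by rewrite rev_path (@eq_path _ _ cadj) // => a b; rewrite cadj_sym.
- by case: s {us As} => //= a s; rewrite rev_cons last_rcons.
- by move=> x; rewrite -rev_rcons -lastI mem_rev => /As.
Qed.

Lemma joined_weaken (A B : cell -> Prop) u v :
  (forall x, A x -> B x) -> joined A u v -> joined B u v.
Proof. by move=> AB [s [h1 h2 h3]]; exists s; split=> // x /h3/AB. Qed.

Lemma ucellE k x y z : [/\ (ucell k x y z).1 k = x, (ucell k x y z).1 (k + 1) = y
  & (ucell k x y z).1 (k + 2) = z].
Proof. exact: pointE. Qed.

Lemma ucell_rot k x y z : ucell (k + 1) y z x = ucell k x y z.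
Proof. by rewrite /ucell point_rot. Qed.

Lemma ucell_facing k x y z : ifacing (k, false) (ucell k x y z) (ucell k (x + 1) y z).
Proof.
have [e1 e2 e3] := pointE k x y z; have [f1 f2 f3] := pointE k (x + 1) y z.
split; first by rewrite /igap /sgd /= f1 e1; ring.
by move=> l; case: (ord3P k l) => -> //= _; rewrite ?e2 ?e3 ?f2 ?f3.
Qed.

Lemma joined_line (A : cell -> Prop) k y z x x' : x <= x' ->
  (forall t, x <= t <= x' -> A (ucell k t y z)) ->
  joined A (ucell k x y z) (ucell k x' y z).
Proof.
move=> le; have -> : x' = x + `|(x' - x)%R|%N%:Z by lia.
elim: `|_|%N => [|n IH] At; first by rewrite addr0; apply/joined_refl/At; lia.
apply: joined_trans (IH _) _; first by move=> t tx; apply: At; lia.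
have -> : x + n.+1%:Z = x + n%:Z + 1 by lia.
by apply: joined_step (ucell_facing _ _ _ _); apply: At; lia.
Qed.

Lemma net_ucell i k x y z : (0 < i <= w)%N -> net_at i x y z -> net_cell i (ucell k x y z).
Proof.
by move=> iw h; split=> //; exists k; rewrite /net_pos; have [-> -> ->] := ucellE k x y z.
Qed.

Lemma link_ucell k x y z : `|x| = half - 1 -> 0 <= y <= r2 * w%:Z -> z = 0 ->
  link_cell (ucell k x y z).
Proof.
by move=> h1 h2 h3; split=> //; exists k; rewrite /link_pos; have [-> -> ->] := ucellE k x y z.
Qed.

Lemma ucell_eta k (u : cell) : u.2 = 1 ->
  u = ucell k (u.1 k) (u.1 (k + 1)) (u.1 (k + 2)).
Proof. by case: u => v t /= ->; rewrite /ucell point_eta. Qed.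

Section Net.
Variable i : nat.
Hypothesis iw : (0 < i <= w)%N.
Local Notation a := (r1 * i%:Z).
Local Notation root k := (ucell k a (half - 3) a).

Lemma run_root k x : `|x| <= half - 2 ->
  joined (net_cell i) (ucell k x (half - 3) a) (root k).
Proof.
have [b1 b2 b3 b4] := index_bounds iw; have [c0 c1 c2 c3 [c4 c5]] := constants.
move=> xh; have lineA t : `|t| <= half - 2 -> net_cell i (ucell k t (half - 3) a).
  by move=> th; apply: net_ucell => //; apply: Or44.
have [le|lt] := lerP x a.
  by apply: joined_line => // t tx; apply: lineA; lia.
by apply: joined_sym; apply: joined_line => [|t tx]; [lia|apply: lineA; lia].
Qed.

Lemma bus_root k x y : `|x| = half - 2 -> 0 <= y <= half - 3 ->
  joined (net_cell i) (ucell k x y a) (root k).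
Proof.
have [b1 b2 b3 b4] := index_bounds iw; have [c0 c1 c2 c3 [c4 c5]] := constants.
move=> xh yh; apply: joined_trans (run_root k (x := x) _); last by rewrite xh.
rewrite -(ucell_rot k x y) -(ucell_rot k x (half - 3)).
apply: joined_line => [|t ty]; first by lia.
by rewrite ucell_rot; apply: net_ucell => //; apply: Or43; split=> //; lia.
Qed.

Lemma column_root k x y z : `|x| = half - 1 -> y = a \/ y = r2 * i%:Z -> 0 <= z <= a ->
  joined (net_cell i) (ucell k x y z) (root k).
Proof.
have [b1 b2 b3 b4] := index_bounds iw; have [c0 c1 c2 c3 [c4 c5]] := constants.
move=> xh yh za.
have colA t : 0 <= t <= a -> net_cell i (ucell k x y t).
  by move=> th; apply: net_ucell => //; apply: Or42.
apply: (@joined_trans _ _ (ucell k x y a)).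
  rewrite -(ucell_rot k x y z) -(ucell_rot (k + 1) y z) -(ucell_rot k x y a) -(ucell_rot (k + 1) y a).
  by apply: joined_line => [|t ty]; [lia|rewrite !ucell_rot; apply: colA; lia].
have yb : 0 <= y <= half - 3 by case: yh => ->; lia.
have busA x' : `|x'| = half - 2 -> net_cell i (ucell k x' y a).
  by move=> xh'; apply: net_ucell => //; apply: Or43.
have colAa : net_cell i (ucell k x y a) by apply: colA; lia.
have [x0|x0] := lerP 0 x.
  apply: joined_trans (bus_root k (x := x - 1) _ yb); last by lia.
  apply: joined_sym; have {2}-> : x = x - 1 + 1 by lia.
  apply: joined_step (ucell_facing _ _ _ _); first by apply: busA; lia.
  by rewrite subrK.
apply: joined_trans (bus_root k (x := x + 1) _ yb); last by lia.
by apply: joined_step (ucell_facing _ _ _ _) => //; apply: busA; lia.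
Qed.

Lemma port_root k x y : `|x| = half -> y = a \/ y = r2 * i%:Z ->
  joined (net_cell i) (ucell k x y 0) (root k).
Proof.
have [b1 b2 b3 b4] := index_bounds iw; have [c0 c1 c2 c3 [c4 c5]] := constants.
move=> xh yh; have portA : net_cell i (ucell k x y 0).
  by apply: net_ucell => //; apply: Or41.
have colA x' : `|x'| = half - 1 -> net_cell i (ucell k x' y 0).
  by move=> xh'; apply: net_ucell => //; apply: Or42; split=> //; lia.
have za : 0 <= (0 : int) <= a by lia.
have [x0|x0] := lerP 0 x.
  apply: joined_trans (column_root k (x := x - 1) _ yh za); last by lia.
  apply: joined_sym; have {2}-> : x = x - 1 + 1 by lia.
  apply: joined_step (ucell_facing _ _ _ _); first by apply: colA; lia.
  by rewrite subrK.
apply: joined_trans (column_root k (x := x + 1) _ yh za); last by lia.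
by apply: joined_step (ucell_facing _ _ _ _) => //; apply: colA; lia.
Qed.

(** At its root the run of the axis [k] touches a bus of the axis [k + 1]. Going round the three
    axes connects the parts of the net at all six faces. *)
Lemma root_next k : joined (net_cell i) (root k) (root (k + 1)).
Proof.
have [b1 b2 b3 b4] := index_bounds iw; have [c0 c1 c2 c3 [c4 c5]] := constants.
have E : half - 2 = half - 3 + 1 by lia.
apply: joined_trans (bus_root (k + 1) (x := half - 2) (y := a) _ _); [|lia|lia].
rewrite -(ucell_rot k) E; apply: joined_step (ucell_facing _ _ _ _).
  by rewrite ucell_rot; apply: net_ucell => //; apply: Or44; split=> //; lia.
by rewrite -E; apply: net_ucell => //; apply: Or43; split=> //; lia.
Qed.

Lemma net_root k u : net_pos i k u.1 -> u.2 = 1 -> joined (net_cell i) u (root k).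
Proof.
move=> + u1; rewrite (ucell_eta k u1) /net_pos; have [-> -> ->] := ucellE k (u.1 k) (u.1 (k + 1)) (u.1 (k + 2)).
case=> [[e1 e2 ->]|[e1 e2 e3]|[e1 e2 ->]|[e1 -> ->]].
- exact: port_root.
- exact: column_root.
- exact: bus_root.
- exact: run_root.
Qed.

Lemma net_joined u v : net_cell i u -> net_cell i v -> joined (net_cell i) u v.
Proof.
move=> [_ u1 [k /net_root/(_ u1) uk]] [_ v1 [l /net_root/(_ v1) vl]].
apply: joined_trans uk _; apply: joined_trans (joined_sym vl).
have := root_next k; have := root_next (k + 1); have := root_next (k + 2); have [-> _ ->] := ord3_add k.
move=> j20 j12 j01; case: (ord3P k l) => ->.
- exact: joined_trans j01 (joined_trans j12 j20).
- exact: j01.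
- exact: joined_trans j01 j12.
Qed.

End Net.

Lemma is_cell_arm d j : (j <= 5)%N -> is_cell (arm d j).
Proof. by move=> j5; apply: Or31; exists d, j. Qed.

Lemma arm_joined d j : (j <= 5)%N -> joined is_cell (arm d j) (hub r3).
Proof.
elim: j => [|j IH] j5; first by rewrite -hub_arm; apply/joined_refl/is_cell_hub.
apply: joined_trans (IH (ltnW j5)); apply: joined_sym.
by apply: joined_step (arm_facing d j5); apply: is_cell_arm; rewrite // ltnW.
Qed.

Lemma link_joined k x y : `|x| = half - 1 -> 0 <= y <= r2 * w%:Z ->
  joined is_cell (ucell k x y 0) (hub r3).
Proof.
move=> xh yh; apply: joined_trans (arm_joined (k, x < 0) (isT : (4 <= 5)%N)).
have -> : arm (k, x < 0) 4 = ucell k x 0 0.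
  congr (_, _); congr point; rewrite /sgd /=.
  by case: ltP xh => h; [rewrite ltr0_norm|rewrite ger0_norm] => // <-; ring.
rewrite -(ucell_rot k x y) -(ucell_rot k x 0); apply: joined_sym; apply: joined_line => [|t ty]; first by lia.
by rewrite ucell_rot; apply: Or32; apply: link_ucell => //; lia.
Qed.

Lemma cell_joined u : is_cell u -> joined is_cell u (hub r3).
Proof.
have [_ _ b3 b4] := @index_bounds w (introT andP (conj w_gt0 (leqnn w))).
have [c0 c1 c2 c3 [c4 c5]] := constants.
case=> [[d [j [j5 ->]]]|[u1 [k [e1 e2 e3]]]|[i nu]]; first exact: arm_joined.
  by rewrite (ucell_eta k u1) e3; apply: link_joined.
have [iw u1 _] := nu; have [a1 a2 a3 a4] := index_bounds iw.
have h1 : `|half - 1| = half - 1 by lia.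
(* This cell belongs both to a column of the net and to a link, which runs through the columns of
   all nets. *)
apply: joined_trans (_ : joined _ _ (ucell ord0 (half - 1) (r1 * i%:Z) 0)) _.
  apply: (@joined_weaken (net_cell i)) => [x nx|]; first by apply: Or33; exists i.
  apply: net_joined => //; apply: net_ucell => //; apply: Or42; split=> //; first by left.
by apply: link_joined => //; lia.
Qed.

Lemma net_not_arm i u : net_cell i u -> ~ is_arm u.
Proof.
have [c0 c1 c2 c3 [c4 c5]] := constants.
move=> [iw _ [k /(net_far iw)[l [m [lm ul um]]]]] [d [j [_ E]]].
have zero x : x <> d.1 -> u.1 x = 0 by move=> /eqP/negPf xd; rewrite E armE xd.
have [ld|/eqP/zero] := eqVneq l d.1; last by lia.
have /zero : m <> d.1 by rewrite -ld; apply/nesym.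
by lia.
Qed.

(** Along [k + 1] the part of the axis [k] reaches at most [half - 3], so it could only meet a run
    of the axis [k + 1]. That run has coordinate [half - 3] along [k + 2], where the former stays
    below [r1 * i], or equal to it. *)
Lemma net_frame i j k v : (0 < i <= w)%N -> (0 < j <= w)%N ->
  net_pos i k v -> net_pos j (k + 1) v -> False.
Proof.
move=> iw jw ni; have [_ /(_ (k + 1))] := net_unit iw ni.
have [b1 b2 b3 b4] := index_bounds iw; have [c0 c1 c2 c3 [c4 c5]] := constants.
have [n1 _ _] := ord3_neq k; move=> /(_ n1)[y0 y3]; rewrite /net_pos.
have [-> -> _] := ord3_add k; case=> -[e1 e2 e3]; try lia.
by case: ni => -[f1 f2 f3]; lia.
Qed.

Lemma net_cell_inj i j u : net_cell i u -> net_cell j u -> i = j.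
Proof.
move=> [iw _ [k ni]] [jw _ [l nj]].
have [c0 c1 c2 c3 [c4 c5]] := constants.
have [a1 a2 a3 a4] := index_bounds iw; have [b1 b2 b3 b4] := index_bounds jw.
have r1n : r1 != 0 by lia.
have r2n : r2 != 0 by lia.
have eq1 : r1 * i%:Z = r1 * j%:Z -> i = j by move=> /(mulfI r1n)[].
have eq2 : r2 * i%:Z = r2 * j%:Z -> i = j by move=> /(mulfI r2n)[].
case: (ord3P k l) => E; rewrite E in nj.
- case: ni nj => -[e1 e2 e3] [] [f1 f2 f3]; try (exfalso; lia);
    try (by apply: eq1; rewrite -e3 -f3);
    by case: e2 => e2; case: f2 => f2; [apply: eq1; rewrite -e2 -f2
      | exfalso; lia | exfalso; lia | apply: eq2; rewrite -e2 -f2].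
- by case: (net_frame iw jw ni nj).
have [_ _ e3] := ord3_add k.
by case: (@net_frame j i (k + 2) u.1 jw iw nj); rewrite e3.
Qed.

(** * The gadget as a substitution *)

Section Digits.
Variable R : realType.
Local Notation P := (size (cells gadget)).
Local Notation digit := (@digit gadget).

Definition idx (u : cell) : nat := index u (cells gadget).

Definition ltouch (x y : nat) : bool := `[< exists d, lcontact R gadget d x y >].

Lemma idxP u : is_cell u -> (idx u < P)%N /\ digit (idx u) = u.
Proof.
by move=> /mem_cells uc; rewrite /idx index_mem; split=> //; apply: nth_index.
Qed.

Lemma digit_cell v : (v < P)%N -> is_cell (digit v).
Proof. by move=> vP; apply/mem_cells/digit_in. Qed.

Lemma idx_digit v : (v < P)%N -> idx (digit v) = v.
Proof. by move=> vP; rewrite /idx index_uniq // cells_uniq. Qed.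

Lemma ltouch_idx u v : is_cell u -> is_cell v -> cadj u v -> ltouch (idx u) (idx v).
Proof.
move=> /idxP[uP du] /idxP[vP dv] /asboolP[d f]; apply/asboolP; exists d.
by apply/lcontactE => //; rewrite du dv.
Qed.

Lemma path_idx u s : path cadj u s -> (forall x, x \in u :: s -> is_cell x) ->
  path ltouch (idx u) (map idx s).
Proof.
move=> us As; rewrite path_map; apply: (sub_in_path (P := [pred x | `[< is_cell x >]])) us.
  by move=> x y /asboolP xc /asboolP yc; apply: ltouch_idx.
by apply/allP => x /As xc; apply/asboolP.
Qed.

Lemma joined_path (A : cell -> Prop) u v : (forall x, A x -> is_cell x) -> joined A u v ->
  exists s, [/\ path ltouch (idx u) s, last (idx u) s = idx v
    & forall x, x \in idx u :: s -> (x < P)%N /\ A (digit x)].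
Proof.
move=> Ac [s [us <- As]]; exists (map idx s); split.
- by apply: path_idx => // x /As/Ac.
- by rewrite last_map.
- by move=> x; rewrite -map_cons => /mapP[y /As Ay ->]; have [h ->] := idxP (Ac _ Ay).
Qed.

(** At a contact of ratio [r1], the ports [r1 * i] of the larger cube meet the ports [r2 * i] of the
    smaller one; equal cubes both use [r2 * i]. *)
Definition port_cell (d : dir) (a : bool) (i : nat) : cell :=
  ucell d.1 (sgd d * half) ((if a then r2 else r1) * i%:Z) 0.

Definition gport d a i := idx (port_cell d a i).

Lemma port_cell0 d a : port_cell d a 0 = arm d 5.
Proof. by rewrite /port_cell mulr0. Qed.

Lemma half_norm d : `|sgd d * half| = half.
Proof. by rewrite sgd_norm ger0_norm //; have [] := constants; lia. Qed.

Lemma port_cell_net d a i : (0 < i <= w)%N -> net_cell i (port_cell d a i).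
Proof.
move=> iw; apply: net_ucell => //; apply: Or41; rewrite half_norm; split=> //.
by case: a; [right|left].
Qed.

Lemma is_cell_port d a i : (i <= w)%N -> is_cell (port_cell d a i).
Proof.
case: i => [|i] iw; first by rewrite port_cell0; apply: is_cell_arm.
by apply: Or33; exists i.+1; apply: port_cell_net.
Qed.

Lemma port_cellE d a i : (port_cell d a i).1 d.1 = sgd d * half /\
  (port_cell d a i).1 (d.1 + 1) = (if a then r2 else r1) * i%:Z.
Proof. by have [] := ucellE d.1 (sgd d * half) ((if a then r2 else r1) * i%:Z) 0. Qed.

Lemma reach_port d a i : reach d (port_cell d a i) = 2 * half + 1.
Proof.
by rewrite /reach (port_cellE d a i).1 mulrA -(mulrA 2) sgd_sqr mulr1.
Qed.

Lemma gport_face d a i : (i <= w)%N -> lface gadget d (gport d a i).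
Proof.
by move=> /(is_cell_port d a)/idxP[_ e]; rewrite /lface /gport e reach_port.
Qed.

Lemma gport_tcontact a b d q q' i : (i <= w)%N -> ltcontact R gadget a b d q q' ->
  ltcontact R gadget a b d (q * P + gport d a i)%N (q' * P + gport (opp d) b i)%N.
Proof.
move=> iw; have [p1 e1] := idxP (is_cell_port d a iw).
have [p2 e2] := idxP (is_cell_port (opp d) b iw).
move=> t; apply: (ltcontact_child p1 p2 (gport_face d a iw) (gport_face (opp d) b iw) t).
rewrite /gport e1 e2 (port_cellE d a i).2 (port_cellE (opp d) b i).2.
by case: a b {t p1 e1 p2 e2} => [] []; rewrite /= ?mul1r // /r2 mulrA.
Qed.

Lemma centre_route d d' : d <> d' -> exists s, [/\ path ltouch (gport d true 0) s,
  uniq (gport d true 0 :: s), all (fun u => u < P)%N s,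
  last (gport d true 0) s = gport d' true 0 & (size s).+1 = 11%N].
Proof.
move=> dd'; rewrite /gport !port_cell0.
pose s := [:: arm d 4; arm d 3; arm d 2; arm d 1; arm d 0;
  arm d' 1; arm d' 2; arm d' 3; arm d' 4; arm d' 5].
have sc u : u \in arm d 5 :: s -> is_cell u.
  rewrite /s !inE; do ?[case/orP]; move=> /eqP->; exact: is_cell_arm.
have down e j : (j < 5)%N -> cadj (arm e j.+1) (arm e j).
  by move=> j5; apply/asboolP; exists (opp e); apply/ifacing_sym/arm_facing.
have up e j : (j < 5)%N -> cadj (arm e j) (arm e j.+1).
  by move=> j5; apply/asboolP; exists e; apply: arm_facing.
have idx_inj u v : is_cell u -> is_cell v -> idx u = idx v -> u = v.
  by move=> /idxP[_ e1] /idxP[_ e2] e; rewrite -e1 -e2 e.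
exists (map idx s); split.
- apply: path_idx sc; rewrite /s /= !down //= (arm0 d d') !up //.
- rewrite -map_cons map_inj_in_uniq; last first.
    by move=> u v /sc uc /sc vc; apply: idx_inj.
  have eqA e j j' : (j <= 5)%N -> (j' <= 5)%N -> (arm e j == arm e j') = (j == j').
    by move=> j5 j'5; apply/eqP/eqP => [/(arm_inj j5 j'5)[]|->].
  have neA j j' : (j <= 5)%N -> (j' < 5)%N -> (arm d j == arm d' j'.+1) = false.
    by move=> j5 j'5; apply/eqP => /(arm_inj j5 j'5)[E []]; rewrite ?E.
  by rewrite /s /= !inE !eqA // !neA.
- by apply/allP => x /mapP[u us ->]; have [] := idxP (sc u _); rewrite // inE us orbT.
- by rewrite last_map.
- by [].
Qed.

Lemma gdepth_face d u : (u < P)%N -> lface gadget d u -> cell_depth d (digit u) = 0%N.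
Proof.
move=> uP fu; case: (cell_at_face (digit_cell uP) fu) => [->|[i [iw u1 h1 h2 h3]]].
  by rewrite depth_arm // eqxx.
have nu : net_cell i (digit u).
  by split=> //; exists d.1; apply: Or41.
rewrite depth_off; last exact: net_not_arm nu.
move: fu; rewrite /lface /reach u1 -mulrA => fu.
have -> : sgd d * (digit u).1 d.1 = half by move: (sgd d * _) fu => x /=; lia.
by rewrite subrr.
Qed.

Lemma gdepth_far d d' u : (u < P)%N -> d <> d' -> lface gadget d' u ->
  (cell_depth d (digit u)).+1 = 11%N.
Proof.
have [c0 c1 c2 c3 [c4 c5]] := constants.
move=> uP dd' fu; case: (cell_at_face (digit_cell uP) fu) => [->|[i [iw u1 h1 h2 h3]]].
  by rewrite depth_arm //; case: eqP => // E; case: dd'.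
have nu : net_cell i (digit u).
  by split=> //; exists d'.1; apply: Or41.
rewrite depth_off; last exact: net_not_arm nu.
have [b1 b2 b3 b4] := index_bounds iw.
suff : 10 <= half - sgd d * (digit u).1 d.1 by move: (sgd d * _) => x; lia.
have small x : `|x| <= half - 10 -> 10 <= half - sgd d * x.
  by rewrite -(sgd_norm d); move: (sgd d * x) => y; lia.
case: (ord3P d'.1 d.1) => E; rewrite E.
- have -> : d = opp d'.
    case: d d' dd' E {fu h1 h2 h3 nu small} => k b [k' b'] /= + E; rewrite E /opp /=.
    by case: b b' => [] [] // ne; case: ne.
  move: fu; rewrite /lface /reach u1 -mulrA sgd_opp mulNr => fu.
  by move: (sgd d' * _) fu => x /=; lia.
- by apply: small; case: h2 => ->; lia.
- by apply: small; rewrite h3; lia.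
Qed.

Definition gadget_substitution : substitution.
Proof.
apply: (@Substitution P 11 w (lcontact R gadget) (lface gadget) (ltcontact R gadget)
  gport (fun d u => cell_depth d (digit u)) (fun i u => net_cell i (digit u))).
- exact: P_gt1.
- by [].
- exact: lcontact_sym.
- exact: lcontact_inj.
- exact: lcontact_irr.
- by move=> d q u v uP vP; apply: lcontact_local.
- by move=> d q q' u v uP vP; apply: lcontact_cross.
- by move=> d u v uP vP; apply: lface_outer.
- by move=> a b d x y; apply: ltcontactW.
- exact: lcontact_typed.
- by move=> d a i /(is_cell_port d a)/idxP[].
- exact: gport_face.
- by move=> d a b; rewrite /gport !port_cell0.
- exact: gport_tcontact.
- exact: centre_route.
- exact: gdepth_face.
- exact: gdepth_far.
- move=> d f u v uP vP /(lcontactE R f uP vP).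
  exact: cell_depth_step (digit_cell uP) (digit_cell vP).
- by move=> i j u; apply: net_cell_inj.
- move=> i d a d' b iw; apply: joined_path => [x nx|]; first by apply: Or33; exists i.
  by apply: net_joined => //; apply: port_cell_net.
move=> u v uP vP.
have [|s [us lu As]] := @joined_path is_cell (digit u) (digit v) (fun x xc => xc).
  exact: joined_trans (cell_joined (digit_cell uP)) (joined_sym (cell_joined (digit_cell vP))).
rewrite !idx_digit // in us lu As; exists s; split=> //.
by apply/allP => x xs; have [|//] := As x; rewrite inE xs orbT.
Defined.

End Digits.

End Gadget.

(** * Conclusion *)

(** Makes the growth exponent at least 1: the central route consists of [scale] distinct digits. *)
Lemma scale_le_base (S : substitution) : (scale S <= base S)%N.
Proof.
have [s [_ us uP _ <-]] := @centre_path S _ _ (@opp_neq (ord0, true)).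
apply: (size_digits us) => v.
by rewrite inE => /orP[/eqP->|/(allP uP)//]; apply: port_lt.
Qed.

Lemma size_gadget w (w_gt0 : (0 < w)%N) :
  (size (cells (gadget w_gt0)) <= 11 ^ 6 * w ^ 9)%N.
Proof.
(* Here [half] is [4w^3 + 10w^2 + 9w + 5], at most [28w^3]. The number [3 * 57^3 + 1] is then
   rounded up to [11^6], convenient for logarithms to base 11. *)
have side : (box_side w <= 57 * w ^ 3)%N.
  rewrite /box_side /half /x1; move: w_gt0; rewrite !expnS expn0 muln1; nia.
have := size_other_cells w; have : (box_side w ^ 3 <= (57 * w ^ 3) ^ 3)%N by rewrite leq_exp2r.
have : (0 < w ^ 9)%N by rewrite expn_gt0 w_gt0.
rewrite expnMn -expnM /=; move: (_ ^ 9)%N (_ ^ 3)%N (size _) => a b c.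
by lia.
Qed.

Theorem theorem1p1 (R : realType) :
  exists K : R, 0 < K /\
    forall (d : nat) (s : R), (3 <= d)%N -> 1 <= s ->
      exists (c : R) (G : connected_graph),
        [/\ 0 < c,
            exists k : R, k <= K * s /\ uniform_polynomial_growth G k,
            uniformly_sphere_packed R d G
          & forall (x : G) (r r' : nat), (1 <= r)%N -> (r < r')%N ->
              exists (n : nat) (p : 'I_n -> seq G),
                c * r%:R `^ s <= n%:R /\
                disjoint_paths (gsphere x r) (gsphere x r') p].
Proof.
(* From [P <= 11^6 * w^9] with [w = 11^n] the exponent is at most [9n + 6], and [n <= s + 1] bounds
   this by [9s + 15 <= 24s], as [s >= 1]. *)
exists 24; split=> // d s d3 s1.
have s0 : 0 <= s by apply: le_trans s1.
(* An integer above [s], so that the width [11 ^ n] is at least [11 ^ s]. *)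
pose n := (Num.truncn s).+1.
have sn : s < n%:R by apply: truncnS_gt.
have ns : n%:R <= s + 1 by rewrite -natr1 lerD2r truncn_le.
have w_gt0 : (0 < 11 ^ n)%N by rewrite expn_gt0.
pose S := gadget_substitution w_gt0 R.
have [|c [c0 hc]] := @substitution_disjoint_paths R S s s0.
  rewrite /= natrX -powR_mulrn //; apply: ler_powR; first by rewrite ler1n.
  exact: ltW.
exists c, (graph S); split=> //; last first.
- by move=> x r r' _; apply: hc.
- apply: (@layout_sphere_packed R (gadget w_gt0) (graph S) id) => // x y.
  exact: iff_sym (rwP (@touchP S x y)).
have l0 : 0 < ln 11%:R :> R by apply: ln_gt0; rewrite ltr1n.
have P0 : 0 < (base S)%:R :> R by rewrite ltr0n base_gt0.
exists (ln (base S)%:R / ln 11%:R); split; last first.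
  apply: substitution_growth; last first.
    rewrite -[scale S]/11%N /powR pnatr_eq0 divfK ?gt_eqF //.
    by rewrite lnK // posrE.
  by rewrite ler_pdivlMr // mul1r ler_ln ?posrE // ler_nat (scale_le_base S).
apply: le_trans (_ : (9 * n + 6)%:R <= _); last by rewrite natrD natrM; lra.
rewrite ler_pdivrMr // mulr_natl -lnXn ?ltr0n // ler_ln ?posrE ?exprn_gt0 //.
rewrite -natrX ler_nat (leq_trans (size_gadget w_gt0)) // addnC expnD mulnC.
by rewrite -expnM mulnC [(n * 9)%N]mulnC.
Qed.
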